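(* Let $A:\mathbb{H}\rightrightarrows\mathbb{H}$ and $B:\mathbb{H}\rightrightarrows\mathbb{H}$ be respectively maximally $\alpha$- and $\beta$-monotone. Suppose that $\mu=\lambda=2$, $\gamma=\delta>0$, $\alpha+\beta>0$ and $\frac{\gamma\alpha\beta}{\alpha+\beta}>-1$, and that $\int_{t_0}^{+\infty}\theta(s)ds=+\infty$. Write $T:=R_{\delta B}^{\mu}R_{\gamma A}^{\lambda}$. Let $u(t)$ be the trajectory (unique strong global solution) of $$\frac{du}{dt}+\theta(t)\,[u(t)-T(u(t))]=f(t),\qquad u(t_0)=u_0\in\mathbb{H}.$$ Then: (i) $\int_{t_0}^{+\infty}\theta(s)\|Tu(s)-u(s)\|^2ds<+\infty$. (ii) $\lim_{t\to+\infty}\|Tu(t)-u(t)\|=0$. (iii) If $T$ satisfies the demiclosedness principle, then there exists $\hat u\in\operatorname{Fix}(T)$ such that $u(t)$ converges weakly to $\hat u$ as $t\to+\infty$.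
   Context: $\mathbb{H}$ is a real Hilbert space, $I$ its identity operator, $t_0>0$, $\theta:[t_0,+\infty)\to[0,+\infty)$ is locally integrable, and $f:[t_0,+\infty)\to\mathbb{H}$ belongs to $L^1([t_0,+\infty))$. A set-valued operator $A:\mathbb{H}\rightrightarrows\mathbb{H}$ is $\alpha$-monotone ($\alpha\in\mathbb{R}$) if $\langle x-y,u-v\rangle\ge\alpha\|x-y\|^2$ whenever $u\in Ax$, $v\in Ay$; it is maximally $\alpha$-monotone if moreover no $\alpha$-monotone operator has a graph strictly containing that of $A$. $J_{\gamma A}=(I+\gamma A)^{-1}$, $R_{\gamma A}^{\lambda}=(1-\lambda)I+\lambda J_{\gamma A}$, $J_{\delta B}=(I+\delta B)^{-1}$, $R_{\delta B}^{\mu}=(1-\mu)I+\mu J_{\delta B}$; under the hypotheses of the claim these are single-valued with full domain (known). $\operatorname{Fix}(T)=\{x:Tx=x\}$. $T$ satisfies the demiclosedness principle if, for every sequence $(x_k)$ converging weakly to $x^*$ with $\|Tx_k-x_k\|\to0$, one has $Tx^*=x^*$. A strong global solution is a function $u:[t_0,+\infty)\to\mathbb{H}$ that is absolutely continuous on each interval $[t_0,b]$, $t_0<b<+\infty$, satisfies the differential equation for almost every $t\ge t_0$, and satisfies $u(t_0)=u_0$; it exists and is unique here.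
   Formalization: The formal theorem additionally assumes that Fix(T) is nonempty; without it the claim fails, e.g. on the real line with A, B the normal cones of {0}, {1} and α=β=γ=δ=1, where Tx=x+2, so for θ=1, f=0 (i) and (ii) fail. *)

(* Defs.v *)
From HB Require Import structures.
From mathcomp Require Import all_boot all_order all_algebra.
From mathcomp Require Import all_classical all_reals all_analysis.

Set Implicit Arguments.
Unset Strict Implicit.
Unset Printing Implicit Defensive.
Import Order.TTheory GRing.Theory Num.Theory.
Import numFieldNormedType.Exports.

Local Open Scope classical_set_scope.
Local Open Scope ring_scope.

(* The inner product [ip] generates the norm, so that a complete normed space
   carrying such an [ip] is a real Hilbert space. *)
Definition inner_product_of_norm (R : realType) (H : normedModType R)
    (ip : {dot H for idfun}) : Prop :=
  forall x : H, ip x x = `|x| ^+ 2.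

Definition weakly_cvg (R : realType) (H : normedModType R)
    (ip : {dot H for idfun}) (F : set_system H) (l : H) : Prop :=
  forall y : H, ip z y @[z --> F] --> ip l y.

Section set_valued_operators.
Context (R : realType) (H : normedModType R).
Implicit Types (A : H -> set H) (T : H -> H).

Definition op_graph A : set (H * H) := [set p | A p.1 p.2].

Definition monotone_op (ip : {dot H for idfun}) (alpha : R) A : Prop :=
  forall x y u v, A x u -> A y v ->
    alpha * `|x - y| ^+ 2 <= ip (x - y) (u - v).

Definition max_monotone_op (ip : {dot H for idfun}) (alpha : R) A : Prop :=
  monotone_op ip alpha A /\
  forall A', monotone_op ip alpha A' -> ~ (op_graph A `<` op_graph A').

(* The set-valued operator (I + gamma A)^-1. *)
Definition inv_id_plus (gamma : R) A : H -> set H :=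
  fun x => [set y | exists2 a, A y a & x = y + gamma *: a].

(* [resolvent gamma A x] is the element of [inv_id_plus gamma A x]; the value is
   arbitrary at points where that set is empty or has several elements. *)
Definition resolvent (gamma : R) A : H -> H :=
  fun x => get (inv_id_plus gamma A x).

Definition relaxed_resolvent (gamma lambda : R) A : H -> H :=
  fun x => (1 - lambda) *: x + lambda *: resolvent gamma A x.

Definition Fix T : set H := [set x | T x = x].

Definition demiclosedness_principle (ip : {dot H for idfun}) T : Prop :=
  forall (x : nat -> H) (l : H),
    weakly_cvg ip (x @ \oo) l ->
    `|T (x k) - x k| @[k --> \oo] --> (0 : R) ->
    T l = l.

End set_valued_operators.

(* The Lebesgue measure on the Lebesgue measurable sets; the library's
   [lebesgue_measure] is its restriction to the Borel sets. *)
Notation leb := (@completed_lebesgue_measure _).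

Section integrability.
Context (R : realType).

Definition locally_integrable_on (D : set R) (h : R -> R) : Prop :=
  forall K : set R, compact K -> K `<=` D -> leb.-integrable K (EFin \o h).

Context (H : normedModType R).

Definition Lebesgue_simple (s : R -> H) : Prop :=
  finite_set (range s) /\
  forall y : H,
    ((wlength (@idfun R))^*)%mu.-cara.-measurable (s @^-1` [set y]).

Definition strongly_measurable (D : set R) (f : R -> H) : Prop :=
  exists s : nat -> R -> H, (forall n, Lebesgue_simple (s n)) /\
    {ae leb, forall t, D t -> s n t @[n --> \oo] --> f t}.

Definition Bochner_integrable (D : set R) (f : R -> H) : Prop :=
  strongly_measurable D f /\
  (\int[leb]_(t in D) `|f t|%:E < +oo)%E.

Definition absolutely_continuous_on (a b : R) (u : R -> H) : Prop :=
  forall e : R, 0 < e -> exists2 d : R, 0 < d &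
    forall (n : nat) (l r : 'I_n -> R),
      (forall i, a <= l i /\ l i <= r i /\ r i <= b) ->
      trivIset setT (fun i => `]l i, r i[%classic) ->
      \sum_i (r i - l i) < d ->
      \sum_i `|u (r i) - u (l i)| < e.

Definition strong_global_solution (t0 : R) (theta : R -> R) (f : R -> H)
    (T : H -> H) (u0 : H) (u : R -> H) : Prop :=
  [/\ forall b, t0 < b -> absolutely_continuous_on t0 b u,
      {ae leb, forall t, t0 <= t ->
         derivable u t 1 /\
         'D_1 u t + theta t *: (u t - T (u t)) = f t}
    & u t0 = u0].

End integrability.

(* Main.v *)
(** Write S = Id - T.  Since T is a composition of two reflected resolvents,
    S is c-cocoercive with c = (1 + gamma alpha beta / (alpha + beta)) / 2 > 0
    (the resolvents have full domain by Minty's theorem).  Hence the explicit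
    gradient steps y |-> y - eta S y, 0 <= eta <= 2 c, decrease both |S y| and
    the distance of y to every zero of S.  Comparing u (t + h) with the gradient
    step of size h theta t at u t bounds the right derivatives of |S (u t)| and
    of |u t - z| by multiples of |f t|, and that of |u t - z|^2 / 2 by
    C |f t| - c theta t |S (u t)|^2.  These bounds integrate because the three
    functions are absolutely continuous, which gives (i), and shows that
    |S (u t)| and |u t - z| are nonincreasing up to the tail integrals of |f|;
    (ii) follows as theta is not integrable.  For (iii), a weak limit of u along
    an ultrafilter is a zero of S by Minty's trick, and Opial's argument
    concludes. *)
Require Import Defs.
From HB Require Import structures.
From mathcomp Require Import all_boot all_order all_algebra.
From mathcomp Require Import all_classical all_reals all_analysis.
From mathcomp Require Import measurable_realfun ring lra.

Set Implicit Arguments.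
Unset Strict Implicit.
Unset Printing Implicit Defensive.
Import Order.TTheory GRing.Theory Num.Theory.
Import numFieldNormedType.Exports.

Local Open Scope classical_set_scope.
Local Open Scope ring_scope.

(** The function [theta] may be unbounded on bounded intervals, so no step size works uniformly in
    time. Each comparison is made at one fixed t, where [h * theta t <= 2 * c] for small h, and the
    pointwise bounds are integrated afterwards. Neither the norm nor [S] need be differentiable:
    upper bounds on right increments replace derivatives, and absolute continuity, with a covering
    of the exceptional null set, turns them into integral inequalities. The hypotheses refer to the
    completed Lebesgue measure, whereas differentiation of integrals is applied to Borel functions,
    hence the passage through a Borel version. A single minimization result gives both Minty's
    theorem and the Riesz representation. Along an ultrafilter every bounded real function
    converges, so weak limits come without extracting subsequences. *)

Section inner_product.
Context (R : realType) (H : completeNormedModType R) (ip : {dot H for idfun}).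
Implicit Types (x y z : H) (a : R).

Lemma ipC x y : ip x y = ip y x.
Proof. by rewrite hermC /= expr0 mul1r. Qed.

Lemma ipDl x y z : ip (x + y) z = ip x z + ip y z.
Proof. exact: linearDl. Qed.

Lemma ipDr x y z : ip x (y + z) = ip x y + ip x z.
Proof. exact: linearDr. Qed.

Lemma ipNl x y : ip (- x) y = - ip x y.
Proof. exact: linearNl. Qed.

Lemma ipNr x y : ip x (- y) = - ip x y.
Proof. exact: linearNr. Qed.

Lemma ipZl a x y : ip (a *: x) y = a * ip x y.
Proof. exact: linearZl_LR. Qed.

Lemma ipZr a x y : ip x (a *: y) = a * ip x y.
Proof. exact: linearZr_LR. Qed.

Definition ipE := (ipDl, ipDr, ipNl, ipNr, ipZl, ipZr).

Hypothesis Hip : inner_product_of_norm ip.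

Lemma normDsq x y : `|x + y| ^+ 2 = `|x| ^+ 2 + 2 * ip x y + `|y| ^+ 2.
Proof. by rewrite -!Hip !ipE (ipC y x); ring. Qed.

Lemma normBsq x y : `|x - y| ^+ 2 = `|x| ^+ 2 - 2 * ip x y + `|y| ^+ 2.
Proof. by rewrite -!Hip !ipE (ipC y x); ring. Qed.

(** The squared norm of [|y| x - |x| y] is nonnegative; expand it and divide by [2 |x| |y|]. *)
Lemma ler_ip x y : ip x y <= `|x| * `|y|.
Proof.
have [->|x0] := eqVneq x 0; first by rewrite -(scale0r x) ipZl mul0r mulr_ge0.
have [->|y0] := eqVneq y 0; first by rewrite -(scale0r y) ipZr mul0r mulr_ge0.
have : 0 <= `| `|y| *: x - `|x| *: y| ^+ 2 by rewrite exprn_ge0.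
rewrite normBsq !normrZ !ipE !normr_id => h.
have xy0 : 0 < `|x| * `|y| by rewrite mulr_gt0 ?normr_gt0.
by rewrite -(ler_pM2l xy0); nra.
Qed.

Lemma ip_norm_le x y : `|ip x y| <= `|x| * `|y|.
Proof.
by rewrite ler_norml ler_ip andbT lerNl -ipNl (le_trans (ler_ip _ _))// normrN.
Qed.

(** Polarization reduces the joint continuity of [ip] to the continuity of the norm. *)
Lemma cvg_ip T (F : set_system T) (FF : Filter F) (f g : T -> H) x y :
  f @ F --> x -> g @ F --> y -> ip (f t) (g t) @[t --> F] --> ip x y.
Proof.
move=> fx gy.
have polar (a b : H) : ip a b = 2^-1 * (`|a + b| ^+ 2 - `|a| ^+ 2 - `|b| ^+ 2).
  by rewrite normDsq; field.
rewrite polar; under eq_fun do rewrite polar.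
have sq (h : T -> H) z : h @ F --> z -> `|h t| ^+ 2 @[t --> F] --> `|z| ^+ 2.
  move=> hz; under eq_fun do rewrite expr2.
  by rewrite expr2; apply: cvgM; apply: cvg_norm.
apply: cvgMr; apply: cvgB; last exact: sq.
by apply: cvgB; apply: sq => //; apply: cvgD.
Qed.

End inner_product.

(** * Minty's theorem and reflected resolvents *)

Section quadratic_minimization.
Context (R : realType) (H : completeNormedModType R) (ip : {dot H for idfun}).
Hypothesis Hip : inner_product_of_norm ip.

Lemma cauchy_norm_cvg (x : nat -> H) :
  (forall e : R, 0 < e -> exists N, forall n, (N <= n)%N -> `|x N - x n| < e) ->
  cvg (x @ \oo).
Proof.
move=> hx; apply/cauchy_cvgP; apply: cauchy_exP => e e0.
have [N hN] := hx e e0; exists (x N), N => // n /hN.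
by rewrite -ball_normE.
Qed.

Definition half_sqnorms (x u : H) : R := 2^-1 * (`|x| ^+ 2 + `|u| ^+ 2).

Lemma half_sqnorms_convex (s : R) x u y v :
  half_sqnorms ((1 - s) *: x + s *: y) ((1 - s) *: u + s *: v) =
  (1 - s) * half_sqnorms x u + s * half_sqnorms y v
  - s * (1 - s) * half_sqnorms (x - y) (u - v).
Proof.
rewrite /half_sqnorms !(normDsq Hip) !normrN !normrZ !ipE !exprMn.
rewrite !real_normK ?num_real//.
by field.
Qed.

Lemma cvg_half_sqnorms (x u : nat -> H) a b : x @ \oo --> a -> u @ \oo --> b ->
  half_sqnorms (x n) (u n) @[n --> \oo] --> half_sqnorms a b.
Proof.
move=> xa ub; rewrite /half_sqnorms.
under eq_fun do rewrite -!Hip.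
rewrite -!Hip; apply: cvgMr; apply: cvgD; exact: cvg_ip.
Qed.

(** A closed convex set of triples, typically the epigraph of a convex function F of (x, u); this
    form lets F take the value +oo without extended reals. *)
Variable C : H -> H -> R -> Prop.
Hypothesis C_convex : forall (s : R) x u r y v q, 0 <= s <= 1 ->
  C x u r -> C y v q ->
  C ((1 - s) *: x + s *: y) ((1 - s) *: u + s *: v) ((1 - s) * r + s * q).
Hypothesis C_closed : forall (x u : nat -> H) (r : nat -> R) a b c,
  (forall n, C (x n) (u n) (r n)) ->
  x @ \oo --> a -> u @ \oo --> b -> r @ \oo --> c -> C a b c.

(* The conclusion is the first-order optimality condition of a minimizer
   [(a, b, r)] of [r + half_sqnorms a b] over [C]. *)
Lemma quadratic_minimizer (x0 u0 : H) (r0 m0 : R) : C x0 u0 r0 ->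
  (forall x u r, C x u r -> m0 <= r + half_sqnorms x u) ->
  exists a b r, C a b r /\ forall y v q, C y v q ->
    r + `|a| ^+ 2 + `|b| ^+ 2 <= q + ip a y + ip b v.
Proof.
move=> C0 Cm.
pose E := [set t | exists x u r, C x u r /\ t = r + half_sqnorms x u].
have lE : has_lbound E.
  by exists m0 => _ [x [u [r [Cxur ->]]]]; exact: Cm Cxur.
have iE : has_inf E.
  by split => //; exists (r0 + half_sqnorms x0 u0), x0, u0, r0.
set m := inf E.
have m_le x u r : C x u r -> m <= r + half_sqnorms x u.
  by move=> Cxur; apply: ge_inf => //; exists x, u, r.
(* The midpoint lies in [C], so [m < m + e - half_sqnorms (x - y) (u - v) / 4]; with the factor 1/2
   of [half_sqnorms] this gives 8. *)
have near_min x u r y v q (e : R) : C x u r -> C y v q ->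
    r + half_sqnorms x u < m + e -> q + half_sqnorms y v < m + e ->
    `|x - y| ^+ 2 < 8 * e /\ `|u - v| ^+ 2 < 8 * e.
  move=> Cx Cy hx hy.
  have := C_convex (s := 2^-1) _ Cx Cy.
  have -> : (0 <= (2^-1 : R) <= 1) = true by apply/andP; split; lra.
  move=> /(_ isT) /m_le; rewrite half_sqnorms_convex.
  have : 0 <= `|x - y| ^+ 2 by rewrite exprn_ge0.
  have : 0 <= `|u - v| ^+ 2 by rewrite exprn_ge0.
  rewrite {3}/half_sqnorms => ? ? ?; split; lra.
have ex_min n : exists t : H * H * R,
    C t.1.1 t.1.2 t.2 /\ t.2 + half_sqnorms t.1.1 t.1.2 < m + n.+1%:R^-1.
  have n0 : 0 < n.+1%:R^-1 :> R by rewrite invr_gt0.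
  have [_ [x [u [r [Cxur ->]]]] hlt] := inf_adherent n0 iE.
  by exists (x, u, r).
pose t n := projT1 (cid (ex_min n)).
have tC n : C (t n).1.1 (t n).1.2 (t n).2 by rewrite /t; case: cid => ? /= [].
have tm n : (t n).2 + half_sqnorms (t n).1.1 (t n).1.2 < m + n.+1%:R^-1.
  by rewrite /t; case: cid => ? /= [].
have close (e : R) : 0 < e -> exists N, forall n, (N <= n)%N ->
    `|(t N).1.1 - (t n).1.1| < e /\ `|(t N).1.2 - (t n).1.2| < e.
  move=> e0.
  have e8 : 0 < e ^+ 2 / 8 by rewrite divr_gt0// exprn_gt0.
  have [N _ /(_ N (leqnn N)) /= hN] := near_infty_natSinv_lt (PosNum e8).
  exists N => n Nn.
  have hn : (n.+1%:R^-1 : R) <= N.+1%:R^-1 by rewrite lef_pV2 ?posrE// ler_nat.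
  have tn : (t n).2 + half_sqnorms (t n).1.1 (t n).1.2 < m + N.+1%:R^-1.
    by rewrite (lt_le_trans (tm n))// lerD2l.
  have [h1 h2] := near_min _ _ _ _ _ _ _ (tC N) (tC n) (tm N) tn.
  have lt_sq (y : H) : `|y| ^+ 2 < 8 * (e ^+ 2 / 8) -> `|y| < e.
    by move=> hy; rewrite -(@ltr_pXn2r _ 2) ?nnegrE ?(ltW e0)//; lra.
  by split; apply: lt_sq; [move: h1|move: h2] => /lt_le_trans; apply;
    rewrite ler_pM2l// ltW.
have cx : cvg ((fun n => (t n).1.1) @ \oo).
  by apply: cauchy_norm_cvg => e /close[N hN]; exists N => n /hN[].
have cu : cvg ((fun n => (t n).1.2) @ \oo).
  by apply: cauchy_norm_cvg => e /close[N hN]; exists N => n /hN[].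
set a := lim ((fun n => (t n).1.1) @ \oo) in cx.
set b := lim ((fun n => (t n).1.2) @ \oo) in cu.
have cv : (t n).2 + half_sqnorms (t n).1.1 (t n).1.2 @[n --> \oo] --> m.
  apply: (@squeeze_cvgr _ _ _ _ (fun=> m) (fun n => m + n.+1%:R^-1)).
  - by near=> n; rewrite m_le ?tC//= ltW ?tm.
  - exact: cvg_cst.
  - rewrite -[X in _ --> X]addr0; apply: cvgD; first exact: cvg_cst.
    exact: cvg_harmonic.
(* The third component converges as a difference of two convergent sequences. *)
have cr : (t n).2 @[n --> \oo] --> m - half_sqnorms a b.
  have -> : (fun n => (t n).2) = (fun n => (t n).2 +
      half_sqnorms (t n).1.1 (t n).1.2 - half_sqnorms (t n).1.1 (t n).1.2).
    by apply/funext => n; rewrite addrK.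
  by apply: cvgB => //; exact: cvg_half_sqnorms.
have Cab := C_closed tC cx cu cr.
exists a, b, (m - half_sqnorms a b); split => // y v q Cy.
(* Minimality against the point of parameter s on the segment towards (y, v, q), divided by s. *)
have first_order (s : R) : 0 < s -> s <= 1 ->
    0 <= q - (m - half_sqnorms a b) + half_sqnorms y v - half_sqnorms a b
         - (1 - s) * half_sqnorms (a - y) (b - v).
  move=> s0 s1.
  have := C_convex (s := s) _ Cab Cy; rewrite (ltW s0) s1 => /(_ isT)/m_le.
  by rewrite half_sqnorms_convex -(pmulr_rge0 _ s0) => ?; lra.
have : 0 <= q - (m - half_sqnorms a b) + half_sqnorms y v - half_sqnorms a b
         - half_sqnorms (a - y) (b - v).
  set K := half_sqnorms (a - y) (b - v) in first_order *.
  have K0 : 0 <= K by rewrite mulr_ge0// addr_ge0// exprn_ge0.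
  (* The factor 1 - s is removed by letting s tend to 0; the choice of s below gives
     [s * K <= e]. *)
  apply/ler_addgt0Pr => e e0.
  have s0 : 0 < Num.min 1 (e / (K + 1)).
    by rewrite lt_min ltr01 divr_gt0//; lra.
  have s1 : Num.min 1 (e / (K + 1)) <= 1 by rewrite ge_min lexx.
  have sK : Num.min 1 (e / (K + 1)) * K <= e.
    have : Num.min 1 (e / (K + 1)) <= e / (K + 1) by rewrite ge_min lexx orbT.
    move=> /(ler_wpM2r K0)/le_trans; apply.
    by rewrite mulrAC ler_pdivrMr; [nra|lra].
  have := first_order _ s0 s1; nra.
rewrite /half_sqnorms !(normBsq Hip) => ?; lra.
Unshelve. all: by end_near.
Qed.

End quadratic_minimization.

(** * Maximal monotone operators and their resolvents *)

Section maximal_monotone.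
Context (R : realType) (H : completeNormedModType R) (ip : {dot H for idfun}).
Hypothesis Hip : inner_product_of_norm ip.
Implicit Types (A G : H -> set H) (x y z u v : H).

(** Adding (x, u) to the graph preserves monotonicity, so maximality forbids that the pair be
    new. *)
Lemma max_monotone_mem (alpha : R) A x u : max_monotone_op ip alpha A ->
  (forall y v, A y v -> alpha * `|x - y| ^+ 2 <= ip (x - y) (u - v)) -> A x u.
Proof.
move=> [Amono Amax] xu; apply: contrapT => nAxu.
pose A' y := A y `|` [set v | y = x /\ v = u].
apply: (Amax A').
  move=> y z v w [Ayv|[-> ->]] [Azw|[-> ->]].
  - exact: Amono.
  - by rewrite distrC -(opprB x) -(opprB u) ipNl ipNr opprK xu.
  - exact: xu.
  - by rewrite !subrr normr0 expr0n mulr0 linear0l.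
split; first by move=> p; left.
by move=> /(_ (x, u)) /=; apply: contra_not nAxu; apply; right.
Qed.

(* Minimizes F(x, u) + |x|^2/2 + |u|^2/2, where F is the Fitzpatrick function
   of G: at the minimizer (a, b) the pair (-b, -a) is monotonically related to
   G, hence belongs to it, which forces a + b = 0. *)
Lemma minty_surjectivity G :
  (forall x y u v, G x u -> G y v -> 0 <= ip (x - y) (u - v)) ->
  (forall x u, (forall y v, G y v -> 0 <= ip (x - y) (u - v)) -> G x u) ->
  exists y, G y (- y).
Proof.
move=> Gmono Gmax.
(* If the graph were empty, every pair, for instance (0, 0), would vacuously be related to it and
   hence belong to it. *)
have [y0 [v0 Gyv0]] : exists y v, G y v.
  apply: contrapT => nG; apply: (nG); exists 0, 0; apply: Gmax => y v Gyv.
  by exfalso; apply: nG; exists y, v.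
(* Epigraph of the Fitzpatrick function: as a supremum of continuous affine functions it is convex
   and closed. *)
pose C x u (r : R) := forall y v, G y v -> ip x v + ip y u - ip y v <= r.
(* Otherwise (x, u) would be monotonically related to [G], hence in [G], and the test at (x, u)
   itself would give the inequality. *)
have C_ge x u r : C x u r -> ip x u <= r.
  move=> Cxur; rewrite leNgt; apply/negP => r_lt.
  have Gxu : G x u.
    apply: Gmax => y v Gyv; have := Cxur _ _ Gyv.
    by rewrite !ipE => ?; lra.
  by have := Cxur _ _ Gxu; lra.
have Cconvex (s : R) x u r y v q : 0 <= s <= 1 -> C x u r -> C y v q ->
    C ((1 - s) *: x + s *: y) ((1 - s) *: u + s *: v) ((1 - s) * r + s * q).
  move=> /andP[s0 s1] Cx Cy z w Gzw.
  by have := Cx _ _ Gzw; have := Cy _ _ Gzw; rewrite !ipE => ? ?; nra.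
have Cclosed (x u : nat -> H) (r : nat -> R) a b c :
    (forall n, C (x n) (u n) (r n)) ->
    x @ \oo --> a -> u @ \oo --> b -> r @ \oo --> c -> C a b c.
  move=> Cn xa ub rc y v Gyv.
  have lim_ip : ip (x n) v + ip y (u n) - ip y v @[n --> \oo] -->
      ip a v + ip y b - ip y v.
    apply: cvgB; last exact: cvg_cst.
    by apply: cvgD; apply: cvg_ip => //; exact: cvg_cst.
  by apply: (ler_cvg_to lim_ip rc); near=> n; exact: Cn.
have C0 : C y0 v0 (ip y0 v0).
  by move=> y v Gyv; have := Gmono _ _ _ _ Gyv0 Gyv; rewrite !ipE => ?; lra.
have Cge0 x u r : C x u r -> 0 <= r + half_sqnorms x u.
  move=> /C_ge xu; have : 0 <= `|x + u| ^+ 2 by rewrite exprn_ge0.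
  by rewrite (normDsq Hip) /half_sqnorms; lra.
have [a [b [r [Cabr min]]]] :=
  quadratic_minimizer Hip Cconvex Cclosed C0 Cge0.
(* On the graph of [G] the Fitzpatrick function is at most [ip y v], so optimality can be tested at
   (y, v, ip y v); combine with [ip a b <= r]. *)
have ab_le y v : G y v -> `|a + b| ^+ 2 <= ip (- b - y) (- a - v).
  move=> Gyv.
  have Cyv : C y v (ip y v).
    by move=> z w Gzw; have := Gmono _ _ _ _ Gyv Gzw; rewrite !ipE => ?; lra.
  have := min _ _ _ Cyv; have := C_ge _ _ _ Cabr.
  by rewrite !ipE (normDsq Hip) (ipC ip b a) (ipC ip y a) => ? ?; lra.
have Gba : G (- b) (- a).
  by apply: Gmax => y v /ab_le; apply: le_trans; rewrite exprn_ge0.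
have := ab_le _ _ Gba; rewrite !subrr linear0l.
rewrite exprn_even_le0//= normr_eq0 addr_eq0 => /eqP ab.
by exists (- b); rewrite -{2}ab.
Unshelve. all: by end_near.
Qed.

(** Since [get] picks an element of any nonempty set, everything reduces to existence. Subtracting
    [alpha] times the identity and [x / gamma] from [A], then rescaling by [gamma / s], gives an
    operator to which Minty's theorem applies; its value -y at y is exactly [x = y + gamma a] with a
    in [A y]. *)
Lemma resolvent_mem (alpha gamma : R) A x : max_monotone_op ip alpha A ->
  0 < gamma -> 0 < 1 + gamma * alpha ->
  A (resolvent gamma A x) (gamma^-1 *: (x - resolvent gamma A x)).
Proof.
move=> hA g0 ga0; set s := 1 + gamma * alpha in ga0.
have gN0 : gamma != 0 by rewrite gt_eqF.
have sN0 : s != 0 by rewrite gt_eqF.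
suff [y [a Aya xE]] : inv_id_plus gamma A x !=set0.
  have : inv_id_plus gamma A x (resolvent gamma A x).
    by apply: getPex; exists y, a.
  move: (resolvent gamma A x) => j [b Ab ->].
  rewrite addrAC subrr add0r scalerA mulVf// scale1r.
  exact: Ab.
pose val y w := alpha *: y + (s / gamma) *: w + gamma^-1 *: x.
have valB y w z w' :
    val y w - val z w' = alpha *: (y - z) + (s / gamma) *: (w - w').
  by rewrite /val opprD addrACA subrr addr0 opprD addrACA -!scalerBr.
have sg : 0 < s / gamma by rewrite divr_gt0.
have [y Gy] : exists y, A y (val y (- y)).
  apply: (@minty_surjectivity (fun y => [set w | A y (val y w)])) => /=.
  - move=> y z w w' Aw Aw'; have := hA.1 _ _ _ _ Aw Aw'.
    by rewrite valB ipDr 2!ipZr Hip lerDl pmulr_rge0.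
  - move=> y w yw; apply: (max_monotone_mem hA) => z b Azb.
    pose w' := (s / gamma)^-1 *: (b - alpha *: z - gamma^-1 *: x).
    have bE : b = val z w'.
      rewrite /val /w' scalerA divff ?gt_eqF// scale1r.
      by rewrite -addrA subrK addrC subrK.
    rewrite bE valB ipDr 2!ipZr Hip lerDl pmulr_rge0//.
    by apply: yw; rewrite -bE.
exists y, (val y (- y)) => //.
rewrite /val scalerDr scalerA divff// scale1r scalerDr !scalerA.
rewrite (mulrC s) mulrA divff// mul1r scalerN addrA.
have -> : (gamma * alpha) *: y - s *: y = - y.
  by rewrite -scalerBl /s opprD addrCA subrr addr0 scaleN1r.
by rewrite addrN add0r.
Qed.

(** With d = x - y and e the difference of the resolvents, the reflections differ by 2e - d. The
    left side is [4 gamma alpha |e|^2], the right side is 4 <e, d - e>, and monotonicity compares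
    the two. *)
Lemma reflected_resolvent_ineq (alpha gamma : R) A x y :
  max_monotone_op ip alpha A -> 0 < gamma -> 0 < 1 + gamma * alpha ->
  gamma * alpha * `|(x - y) +
      (relaxed_resolvent gamma 2 A x - relaxed_resolvent gamma 2 A y)| ^+ 2 <=
  `|x - y| ^+ 2 -
    `|relaxed_resolvent gamma 2 A x - relaxed_resolvent gamma 2 A y| ^+ 2.
Proof.
move=> hA g0 ga0.
have := hA.1 _ _ _ _ (resolvent_mem x hA g0 ga0) (resolvent_mem y hA g0 ga0).
have PE z : relaxed_resolvent gamma 2 A z = 2 *: resolvent gamma A z - z.
  by rewrite /relaxed_resolvent addrC -(scaleN1r z); congr (_ + _ *: _); ring.
rewrite !PE; move: (resolvent gamma A x) (resolvent gamma A y) => j k.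
rewrite -scalerBr.
set d := x - y; set e := j - k.
have -> : x - j - (y - k) = d - e.
  by rewrite /d /e !opprD !opprK addrACA.
have -> : 2 *: j - x - (2 *: k - y) = 2 *: e - d.
  by rewrite /d /e scalerBr !opprD !opprK addrACA.
have -> : d + (2 *: e - d) = 2 *: e by rewrite addrCA subrr addr0.
rewrite ipZr -(ler_pM2l g0) (mulrA gamma) mulVKf ?gt_eqF//.
by clearbody d e; rewrite -!Hip !ipE (ipC ip e d) => ?; lra.
Qed.

(* The constant comes from the inequality
   [alpha beta / (alpha + beta) |p - q|^2 <= alpha |p|^2 + beta |q|^2] with
   [p = d + r] and [q = r + e]. *)
Lemma two_step_cocoercive (alpha beta gamma : R) (d r e : H) :
  0 < gamma -> 0 < alpha + beta ->
  gamma * alpha * `|d + r| ^+ 2 <= `|d| ^+ 2 - `|r| ^+ 2 ->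
  gamma * beta * `|r + e| ^+ 2 <= `|r| ^+ 2 - `|e| ^+ 2 ->
  (1 + gamma * alpha * beta / (alpha + beta)) / 2 * `|d - e| ^+ 2 <=
    ip (d - e) d.
Proof.
move=> g0 ab0 hd he.
have ipde : 2 * ip (d - e) d = `|d - e| ^+ 2 + `|d| ^+ 2 - `|e| ^+ 2.
  by rewrite -!Hip !ipE (ipC ip e d); ring.
suff : gamma * alpha * beta / (alpha + beta) * `|d - e| ^+ 2 <=
    gamma * alpha * `|d + r| ^+ 2 + gamma * beta * `|r + e| ^+ 2 by lra.
(* After multiplication by [alpha + beta], the two sides differ by exactly
   [gamma |alpha p + beta q|^2]. *)
have := mulr_ge0 (ltW g0)
  (exprn_ge0 2 (normr_ge0 (alpha *: (d + r) + beta *: (r + e)))).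
rewrite mulrAC ler_pdivrMr// -!Hip !ipE (ipC ip e d) (ipC ip e r) (ipC ip r d).
by move=> ?; lra.
Qed.

Lemma reflected_composition_cocoercive (alpha beta gamma : R) A B x y :
  max_monotone_op ip alpha A -> max_monotone_op ip beta B ->
  0 < gamma -> 0 < alpha + beta ->
  -1 < gamma * alpha * beta / (alpha + beta) ->
  forall T, T = relaxed_resolvent gamma 2 B \o relaxed_resolvent gamma 2 A ->
  (1 + gamma * alpha * beta / (alpha + beta)) / 2 *
    `|(x - T x) - (y - T y)| ^+ 2 <= ip ((x - T x) - (y - T y)) (x - y).
Proof.
move=> hA hB g0 ab0 gab T ->.
(* One of [alpha], [beta] may be negative. The factors [1 + gamma alpha] and [1 + gamma beta] have
   product above 1 and sum above 2, which makes both positive, as the resolvents require. *)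
have prod_gt1 : 1 < (1 + gamma * alpha) * (1 + gamma * beta).
  have : -(alpha + beta) < gamma * alpha * beta.
    by move: gab; rewrite ltr_pdivlMr// mulN1r.
  by move=> h; have := mulr_gt0 g0 (etrans (subr_gt0 _ _) h) => ?; lra.
have sum_gt2 : 2 < (1 + gamma * alpha) + (1 + gamma * beta) by nra.
have pos (a b : R) : 1 < a * b -> 2 < a + b -> 0 < a.
  by move=> ab1 ab2; rewrite ltNge; apply/negP => a0; nra.
have ga0 := pos _ _ prod_gt1 sum_gt2.
have gb0 : 0 < 1 + gamma * beta by apply: (pos _ (1 + gamma * alpha)); lra.
have stepA := reflected_resolvent_ineq x y hA g0 ga0.
have stepB := reflected_resolvent_ineq (relaxed_resolvent gamma 2 A x)
  (relaxed_resolvent gamma 2 A y) hB g0 gb0.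
have TB z w z' w' : z - w - (z' - w') = z - z' - (w - w') :> H.
  by rewrite !opprD !opprK addrACA.
by rewrite /= TB; exact: (two_step_cocoercive g0 ab0 stepA stepB).
Qed.

End maximal_monotone.

(** * Weak limits *)

Section weak_topology.
Context (R : realType) (H : completeNormedModType R) (ip : {dot H for idfun}).
Hypothesis Hip : inner_product_of_norm ip.

Lemma cvgr_ge_lim T (F : set_system T) (f : T -> R) (x l : R) :
  ProperFilter F -> f @ F --> l -> F [set t | x <= f t] -> x <= l.
Proof.
move=> FP fl xf; rewrite -(cvg_lim (@norm_hausdorff _ _) fl).
by apply: limr_ge => //; apply/cvg_ex; exists l.
Qed.

(** The representing vector is the minimizer of [|x|^2 / 2 - L x]: [C] is the graph of -L, with the
    second component frozen at 0. *)
Lemma riesz_representation (L : H -> R) (M : R) :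
  (forall a x y, L (a *: x + y) = a * L x + L y) ->
  (forall x, `|L x| <= M * `|x|) -> exists p, forall y, L y = ip p y.
Proof.
move=> Llin LM.
have LD x y : L (x + y) = L x + L y by rewrite -[x]scale1r Llin mul1r scale1r.
have L0 : L 0 = 0.
  apply/normr0_eq0/le_anti.
  by rewrite normr_ge0 andbT (le_trans (LM 0))// normr0 mulr0.
have LZ a x : L (a *: x) = a * L x by rewrite -[_ *: _]addr0 Llin L0 addr0.
pose C (x u : H) (r : R) := u = 0 /\ r = - L x.
have Cconvex (s : R) x u r y v q : 0 <= s <= 1 -> C x u r -> C y v q ->
    C ((1 - s) *: x + s *: y) ((1 - s) *: u + s *: v) ((1 - s) * r + s * q).
  move=> _ [-> ->] [-> ->]; split; first by rewrite !scaler0 addr0.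
  by rewrite LD !LZ; ring.
have LB x y : L (x - y) = L x - L y by rewrite LD -scaleN1r LZ mulN1r.
have Cclosed (x u : nat -> H) (r : nat -> R) a b c :
    (forall n, C (x n) (u n) (r n)) ->
    x @ \oo --> a -> u @ \oo --> b -> r @ \oo --> c -> C a b c.
  move=> Cn xa ub rc.
  have uE : u = fun=> 0 by apply/funext => n; have [] := Cn n.
  have rE : r = fun n => - L (x n) by apply/funext => n; have [] := Cn n.
  split.
    move: ub; rewrite uE => /(cvg_unique (@norm_hausdorff _ _)); apply.
    exact: cvg_cst.
  move: rc; rewrite rE => /(cvg_unique (@norm_hausdorff _ _)); apply.
  apply: cvgN; apply/cvgrPdist_le => e e0.
  have M0 : 0 < `|M| + 1 by rewrite ltr_wpDl.
  move/cvgrPdist_le : xa => /(_ (e / (`|M| + 1))).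
  rewrite divr_gt0// => /(_ isT).
  apply: filterS => n hn; rewrite -LB (le_trans (LM _))//.
  rewrite (@le_trans _ _ ((`|M| + 1) * `|a - x n|))//.
    by rewrite ler_wpM2r// (le_trans (ler_norm _))// lerDl.
  by rewrite mulrC -ler_pdivlMr.
have C0 : C 0 0 0 by split => //; rewrite L0 oppr0.
have Cge x u r : C x u r -> - (M ^+ 2) / 2 <= r + half_sqnorms x u.
  move=> [-> ->]; rewrite /half_sqnorms normr0 expr0n addr0.
  have := LM x; rewrite ler_norml => /andP[_ ?].
  by have := sqr_ge0 (M - `|x|); nra.
have [a [b [r [[-> ->] min]]]] :=
  quadratic_minimizer Hip Cconvex Cclosed C0 Cge.
exists a => y; apply/eqP; rewrite -subr_eq0; apply/negPn/negP => D0.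
pose D := L y - ip a y; rewrite -/D in D0.
set K := - L a + `|a| ^+ 2 in min.
(* The multiple of y is chosen so that optimality would read K <= K - 1. *)
have := min (((1 - K) / D) *: y) 0 _ (conj erefl erefl).
rewrite normr0 expr0n/= addr0 LZ ipZr linear0l addr0 -mulrN -mulrDr.
have -> : - L y + ip a y = - D by rewrite /D opprB addrC.
by rewrite mulrN mulfVK// -/K; lra.
Qed.

(** Compactness of [-M, M] gives a cluster point, and an ultrafilter converges to each of its
    cluster points. *)
Lemma ultrafilter_bounded_cvg T (F : set_system T) (f : T -> R) (M : R) :
  UltraFilter F -> F [set t | `|f t| <= M] -> cvg (f @ F).
Proof.
move=> FU fM.
have FP : ProperFilter F by exact: ultra_proper.
have [] := @segment_compact R (- M) M (f @ F) _.
  rewrite /fmap /=; apply: filterS fM => t /=.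
  by rewrite in_itv /= ler_norml.
move=> l [_ cl]; apply/cvg_ex; exists l => V lV.
have [//|FnV] := in_ultra_setVsetC (f @^-1` V) FU.
by have [y [nVy Vy]] := cl (~` V) V FnV lV.
Qed.

(** Weak compactness of balls: the limits of [ip (f t) y] form a bounded linear functional of y,
    represented by Riesz. *)
Lemma ultrafilter_weak_cvg T (F : set_system T) (f : T -> H) (M : R) :
  UltraFilter F -> F [set t | `|f t| <= M] ->
  exists p, weakly_cvg ip (f @ F) p.
Proof.
move=> FU fM.
have FP : ProperFilter F by exact: ultra_proper.
have fip y : F [set t | `|ip (f t) y| <= M * `|y|].
  apply: filterS fM => t /= ft.
  by rewrite (le_trans (ip_norm_le Hip _ _))// ler_wpM2r.
have cip y : cvg (ip (f t) y @[t --> F]).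
  exact: ultrafilter_bounded_cvg (fip y).
pose L y : R := lim (ip (f t) y @[t --> F]).
have Llin a x y : L (a *: x + y) = a * L x + L y.
  apply/cvg_lim => //.
  have -> : (fun t => ip (f t) (a *: x + y)) =
            (fun t => a * ip (f t) x + ip (f t) y).
    by apply/funext => t; rewrite ipDr ipZr.
  by apply: cvgD; [apply: cvgMr; exact: cip|exact: cip].
have LM y : `|L y| <= M * `|y|.
  have cL : ip (f t) y @[t --> F] --> L y by exact: cip.
  rewrite -lerN2; apply: (cvgr_ge_lim FP (cvgN (cvg_norm cL))).
  by apply: filterS (fip y) => t /=; rewrite lerN2.
have [p Lp] := riesz_representation Llin LM.
by exists p => y; rewrite -Lp; exact: cip.
Qed.

Lemma cocoercive_lipschitz (c : R) (S : H -> H) : 0 < c ->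
  (forall x y, c * `|S x - S y| ^+ 2 <= ip (S x - S y) (x - y)) ->
  forall x y, `|S x - S y| <= c^-1 * `|x - y|.
Proof.
move=> c0 Sco x y; have [->|S0] := eqVneq (S x - S y) 0.
  by rewrite normr0 mulr_ge0// invr_ge0 ltW.
have N0 : 0 < `|S x - S y| by rewrite normr_gt0.
rewrite ler_pdivlMl// -(ler_pM2l N0).
by rewrite mulrCA -expr2 (le_trans (Sco _ _))// ler_ip.
Qed.

(* Minty's trick: test the limiting inequality at [p - s *: S p] *)
Lemma cocoercive_weak_zero (c : R) (S : H -> H) T (F : set_system T)
    (f : T -> H) (p : H) : ProperFilter F -> 0 < c ->
  (forall x y, c * `|S x - S y| ^+ 2 <= ip (S x - S y) (x - y)) ->
  (exists M, F [set t | `|f t| <= M]) ->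
  weakly_cvg ip (f @ F) p -> `|S (f t)| @[t --> F] --> (0 : R) -> S p = 0.
Proof.
move=> FP c0 Sco [M fM] fp Sf0.
(* Limit of <S (f t) - S y, f t - y> >= 0: the term with [S (f t)] vanishes because [f] is bounded
   and [S (f t)] tends to 0 in norm. *)
have test y : 0 <= ip (- S y) (p - y).
  have Sfy : ip (S (f t)) (f t - y) @[t --> F] --> (0 : R).
    apply: norm_cvg0; apply: (@squeeze_cvgr _ _ _ _ (fun=> 0)
      (fun t => `|S (f t)| * (M + `|y|))).
    - apply: filterS fM => t /= ft; rewrite normr_ge0/=.
      rewrite (le_trans (ip_norm_le Hip _ _))// ler_wpM2l//.
      by rewrite (le_trans (ler_normB _ _))// lerD2r.
    - exact: cvg_cst.
    - by rewrite -(mul0r (M + `|y|)); exact: cvgMl.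
  have lim_ip : ip (S (f t)) (f t - y) - (ip (f t) (S y) - ip (S y) y)
      @[t --> F] --> 0 - (ip p (S y) - ip (S y) y).
    apply: cvgB => //; apply: cvgB; last exact: cvg_cst.
    exact: fp.
  have -> : ip (- S y) (p - y) = 0 - (ip p (S y) - ip (S y) y).
    by rewrite !ipE (ipC ip p); ring.
  apply: (cvgr_ge_lim FP lim_ip); apply: nearW => t /=.
  have := Sco (f t) y.
  have := mulr_ge0 (ltW c0) (exprn_ge0 2 (normr_ge0 (S (f t) - S y))).
  move=> /le_trans/[apply]; rewrite !ipE (ipC ip (f t)) => ?; lra.
have Sp_le (s : R) : 0 < s -> `|S p| ^+ 2 <= s * (c^-1 * `|S p| ^+ 2).
  move=> s0; have := test (p - s *: S p).
  have -> : p - (p - s *: S p) = s *: S p by rewrite opprB addrC subrK.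
  rewrite ipNl ipZr -mulrN pmulr_rge0// => h.
  have := cocoercive_lipschitz c0 Sco p (p - s *: S p).
  have -> : p - (p - s *: S p) = s *: S p by rewrite opprB addrC subrK.
  rewrite normrZ gtr0_norm// => lip.
  have := ler_ip Hip (S p - S (p - s *: S p)) (S p).
  rewrite ipDl ipNl Hip => h2.
  by have h3 := ler_wpM2r (normr_ge0 (S p)) lip; lra.
(* With s = c / 2 the factor s / c is 1/2, which forces [S p] to vanish. *)
have := Sp_le _ (divr_gt0 c0 (ltr0n R 2)).
rewrite mulrCA -(mulrA c) mulKf ?gt_eqF// => ?.
apply/normr0_eq0/eqP; rewrite -sqrf_eq0; apply/eqP/le_anti.
by rewrite exprn_ge0// andbT; lra.
Qed.

End weak_topology.

(** * Absolutely continuous functions and Lebesgue integrals *)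

Section absolute_continuity.
Context (R : realType).
Implicit Types (a b t e : R) (psi : R -> R).

Lemma measure_disjoint_itvoo n (l r : 'I_n -> R) :
  (forall i, l i <= r i) -> trivIset setT (fun i => `]l i, r i[%classic) ->
  lebesgue_measure (\big[setU/set0]_i `]l i, r i[%classic) =
  (\sum_i (r i - l i))%:E.
Proof.
move=> lr tI; rewrite measure_bigsetU_ord// -sumEFin; apply: eq_bigr => i _.
apply: (etrans (lebesgue_measure_itv `]l i, r i[)); rewrite /= lte_fin.
case: ifPn => //.
by rewrite -leNgt => rl; rewrite (@le_anti _ _ (l i) (r i)) ?lr// subrr.
Qed.

Lemma absolutely_continuous_on_dist (H : normedModType R) a b (u : R -> H) :
  absolutely_continuous_on a b u -> forall e, 0 < e -> exists2 d : R, 0 < d &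
  forall s t, a <= s -> s <= t -> t <= b -> t - s < d -> `|u t - u s| < e.
Proof.
move=> acu e e0; have [d d0 hd] := acu e e0; exists d => // s t sa st tb std.
have := hd 1%N (fun=> s) (fun=> t); rewrite !big_ord_recl !big_ord0 !addr0.
apply => //; apply/trivIsetP => i j _ _.
by rewrite (ord1 i) (ord1 j) eqxx.
Qed.

Lemma absolutely_continuous_onD a b (phi psi : R -> R) :
  absolutely_continuous_on a b phi -> absolutely_continuous_on a b psi ->
  absolutely_continuous_on a b (fun t => phi t + psi t).
Proof.
move=> ac1 ac2 e e0; have e2 : 0 < e / 2 by rewrite divr_gt0.
have [d1 d10 h1] := ac1 _ e2; have [d2 d20 h2] := ac2 _ e2.
exists (Num.min d1 d2); first by rewrite lt_min d10.
move=> n l r hlr tI; rewrite lt_min => /andP[s1 s2].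
rewrite [e]splitr.
apply: le_lt_trans (ltrD (h1 _ _ _ hlr tI s1) (h2 _ _ _ hlr tI s2)).
rewrite -big_split; apply: ler_sum => i _ /=.
by rewrite opprD addrACA ler_normD.
Qed.

Lemma absolutely_continuous_on_comp (H : normedModType R) a b (u : R -> H)
    psi (K : R) : absolutely_continuous_on a b u ->
  (forall s t, a <= s -> s <= t -> t <= b ->
    `|psi t - psi s| <= K * `|u t - u s|) ->
  absolutely_continuous_on a b psi.
Proof.
move=> acu psiK e e0; have K0 : 0 < `|K| + 1 by rewrite ltr_wpDl.
have [d d0 hd] := acu (e / (`|K| + 1)) (divr_gt0 e0 K0).
exists d => // n l r hlr tI hs.
have := hd _ _ _ hlr tI hs; rewrite ltr_pdivlMr// mulrC mulr_sumr.
apply: le_lt_trans; apply: ler_sum => i _.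
have [al [lr rb]] := hlr i.
rewrite (le_trans (psiK _ _ al lr rb))// ler_wpM2r//.
by rewrite (le_trans (ler_norm _))// lerDl.
Qed.

(* The exceptional null set [N] is covered by a small open set [U]; [V t] bounds
   what [psi] can gain on [U] up to time [t], and a continuity argument shows
   that [psi t <= psi a + e (t - a) + V t] propagates from [a] to [b]. *)
Lemma ac_nonincreasing a b psi (N : set R) : a <= b ->
  absolutely_continuous_on a b psi -> lebesgue_measure.-negligible N ->
  (forall t, a <= t -> t < b -> ~ N t -> forall e, 0 < e ->
    exists2 rho, 0 < rho &
      forall h, 0 < h -> h < rho -> psi (t + h) - psi t <= e * h) ->
  psi b <= psi a.
Proof.
move=> ab ac Nnull dpsi.
suff approx e : 0 < e -> psi b <= psi a + e * (b - a) + e.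
  apply/ler_addgt0Pr => e e0.
  have k0 : 0 < b - a + 1 by rewrite ltr_wpDl// subr_ge0.
  have := approx _ (divr_gt0 e0 k0); rewrite -addrA -{2}[e / _]mulr1 -mulrDr.
  by rewrite divfK ?gt_eqF.
move=> e0; have [d d0 hd] := ac e e0.
have [U [oU NU muU]] : exists U, [/\ open U, N `<=` U &
    (lebesgue_measure U < d%:E)%E].
  have d20 : 0 < d / 2 by rewrite divr_gt0.
  have [U [oU NU muU]] := outer_measure_open_le N d20.
  exists U; split => //; apply: le_lt_trans muU _.
  by move/negligible_outer_measure : Nnull => ->; rewrite add0e lte_fin; lra.
pose fam t n (l r : 'I_n -> R) := [/\
  forall i, a <= l i /\ l i <= r i /\ r i <= t,
  forall i, `]l i, r i[ `<=` U & trivIset setT (fun i => `]l i, r i[%classic)].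
pose gains t := [set s | exists n (l r : 'I_n -> R), fam t n l r /\
  s = \sum_i `|psi (r i) - psi (l i)|].
(* At most e for t <= b: the intervals lie in [U], whose measure is below the d that absolute
   continuity attaches to e. *)
pose V t := sup (gains t).
have gains0 t : gains t 0.
  exists 0%N, (fun=> 0), (fun=> 0); rewrite big_ord0; split => //.
  by split; [case|case|move=> [] ].
have gains_le t : t <= b -> ubound (gains t) e.
  move=> tb _ [n [l [r [[lr lU tI] ->]]]]; apply/ltW/hd => //.
    by move=> i; have [? [? ?]] := lr i; do 2?split => //; exact: le_trans tb.
  rewrite -lte_fin -measure_disjoint_itvoo//; last first.
    by move=> i; have [_ []] := lr i.
  apply: le_lt_trans muU; rewrite le_measure// ?inE//.
  - by apply: bigsetU_measurable.
  - exact: measurable_realfun.open_measurable.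
  - apply: (big_ind (fun A => A `<=` U)) => // A B AU BU.
    by rewrite subUset.
have V_le t : t <= b -> V t <= e.
  by move=> tb; apply: ge_sup; [exists 0|exact: gains_le].
have le_V t s : t <= b -> gains t s -> s <= V t.
  by move=> tb; apply: ub_le_sup; exists e; exact: gains_le.
have V_homo s t : s <= t -> t <= b -> V s <= V t.
  move=> st tb; apply: ge_sup; first by exists 0.
  move=> _ [n [l [r [[lr lU tI] ->]]]]; apply: le_V => //.
  exists n, l, r; split => //; split => // i.
  by have [? [? ?]] := lr i; do 2?split => //; exact: le_trans st.
have V_step s t : a <= s -> s <= t -> t <= b -> `]s, t[ `<=` U ->
    V s + `|psi t - psi s| <= V t.
  move=> as_ st tb stU; rewrite -lerBrDr; apply: ge_sup; first by exists 0.
  move=> _ [n [l [r [[lr lU tI] ->]]]]; rewrite lerBrDr; apply: le_V => //.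
  (* The interval from s to t takes index [ord0]; [unlift] recovers the old ones at the other
     indices. *)
  exists n.+1, (fun i => oapp l s (unlift ord0 i)),
    (fun i => oapp r t (unlift ord0 i)).
  split; last first.
    rewrite big_ord_recl unlift_none/= addrC; congr (_ + _).
    by apply: eq_bigr => i _; rewrite liftK.
  split.
  - move=> i; case: unliftP => [j _|_] /=; last by [].
    by have [? [? ?]] := lr j; do 2?split => //; exact: le_trans st.
  - by move=> i; case: unliftP => [j _|_] /=; [exact: lU|].
  - have disj j : `]l j, r j[%classic `&` `]s, t[%classic = set0.
      apply/seteqP; split => // x [] /=.
      rewrite !in_itv/= => /andP[_ xr] /andP[sx _]; have [_ [_ rs]] := lr j.
      by have := lt_trans (lt_le_trans xr rs) sx; rewrite ltxx.
    apply/trivIsetP => i j _ _; case: (unliftP ord0 i) => [i' ->|->];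
      case: (unliftP ord0 j) => [j' ->|->] //=.
    + by rewrite (inj_eq lift_inj) => ij; move/trivIsetP : tI; exact.
    + by move=> _; rewrite setIC.
pose Q := [set t | a <= t <= b /\ psi t <= psi a + e * (t - a) + V t].
have Qa : Q a.
  by rewrite /Q/= lexx ab subrr mulr0 addr0 lerDl; split => //; exact: le_V.
have Qb : ubound Q b by move=> t [/andP[]].
have sQ : has_sup Q by split; [exists a|exists b].
set s := sup Q.
have as_ : a <= s by exact: ub_le_sup (sQ.2) _ Qa.
have sb : s <= b by apply: ge_sup => //; exact: sQ.1.
have Qs : psi s <= psi a + e * (s - a) + V s.
  apply/ler_addgt0Pr => eta eta0.
  have [rho rho0 hrho] := absolutely_continuous_on_dist ac eta0.
  have [t [/andP[at_ tb] Qt] ts] := sup_adherent rho0 sQ.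
  have t_le : t <= s by apply: ub_le_sup (sQ.2) _ _; split => //; rewrite at_.
  have std : s - t < rho by rewrite ltrBlDr addrC -ltrBlDr.
  have := ler_norm (psi s - psi t).
  move=> /le_lt_trans/(_ (hrho _ _ at_ t_le sb std)).
  have := V_homo _ _ t_le sb.
  have : e * (t - a) <= e * (s - a) by rewrite ler_pM2l// lerD2r.
  by lra.
suff -> : b = s by rewrite (le_trans Qs)// lerD2l V_le.
apply/eqP; rewrite eq_le sb andbT leNgt; apply/negP => s_lt.
suff [h h0 [shb Qsh]] : exists2 h, 0 < h & s + h <= b /\
    psi (s + h) <= psi a + e * (s + h - a) + V (s + h).
  have : s + h <= s.
    by apply: ub_le_sup (sQ.2) _ _; split => //; rewrite shb andbT; lra.
  by lra.
have bs0 : 0 < b - s by rewrite subr_gt0.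
(* At a point of [N] a whole neighbourhood lies in [U] and [V] absorbs the gain; elsewhere the bound
   on right increments supplies the slope e. *)
have [Ns|nNs] := pselect (N s).
- have : \forall h \near 0^'+, 0 < h /\ h < b - s /\ `]s - h, s + h[ `<=` U.
    near=> h; split; [|split].
    + by near: h; exact: nbhs_right_gt.
    + by near: h; exact: nbhs_right_lt.
    + by near: h; apply: open_itvoo_subset => //; exact: NU.
  move=> /filter_ex[h [h0 [hbs hU]]]; exists h => //.
  have shb : s + h <= b by lra.
  split => //.
  have ssh : s <= s + h by lra.
  have := V_step _ _ as_ ssh shb.
  have := ler_norm (psi (s + h) - psi s).
  have : e * (s - a) <= e * (s + h - a) by rewrite ler_pM2l//; lra.
  move=> h1 h2 /(_ _)/wrap[].
    move=> x /=; rewrite in_itv/= => /andP[sx xs]; apply: hU.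
    by rewrite /= in_itv/=; apply/andP; split; lra.
  by lra.
- have [rho rho0 hrho] := dpsi _ as_ s_lt nNs _ e0.
  pose h := Num.min (rho / 2) (b - s).
  have h0 : 0 < h by rewrite lt_min bs0 divr_gt0.
  have hrho2 : h < rho by rewrite gt_min; apply/orP; left; lra.
  have hbs : h <= b - s by rewrite ge_min lexx orbT.
  have shb : s + h <= b by lra.
  exists h => //; split => //.
  have := hrho h h0 hrho2.
  have : V s <= V (s + h) by apply: V_homo => //; lra.
  by lra.
Unshelve. all: by end_near.
Qed.
End absolute_continuity.

(** * Borel functions and the completed Lebesgue measure *)

Section completed_measure.
Context (R : realType).
Local Notation mu := (@lebesgue_measure R).
Local Notation cR := (caratheodory_type ((wlength (@idfun R))^*)%mu).
Implicit Types (k g : R -> R) (D : set R).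

Lemma measurable_completed D : measurable D -> measurable (D : set cR).
Proof. exact: sub_caratheodory. Qed.

Lemma negligible_completed (N : set R) : mu.-negligible N <-> leb.-negligible N.
Proof.
split=> [[A [mA A0 NA]]|[A [mA A0 NA]]].
  by exists A; split => //; exact: measurable_completed.
apply/negligible_outer_measure/le_anti; rewrite outer_measure_ge0 andbT -A0.
exact: le_outer_measure.
Qed.

Lemma measurable_fun_completed D g : measurable D -> measurable_fun D g ->
  measurable_fun (D : set cR) g.
Proof. by move=> mD mg _ Y mY; apply: measurable_completed; exact: mg. Qed.

(* On each set [k > q], [q] rational, replace a completed-measurable set by a
   Borel subset; the countably many errors form one null set, on which the
   function is set to [0]. *)
Lemma borel_version k : measurable_fun (setT : set cR) k ->
  exists2 g : R -> R, measurable_fun setT g &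
    mu.-negligible [set t | g t != k t].
Proof.
move=> mk.
have split_q (q : rat) : exists AN : set R * set R,
    [/\ measurable AN.1, mu.-negligible AN.2 &
        AN.1 `|` AN.2 = [set t | ratr q < k t]].
  have : completed_algebra_gen mu [set t | ratr q < k t].
    rewrite -g_sigma_completed_algebra_genE completed_caratheodory_measurable.
    by have := mk measurableT _ (measurable_itv `]ratr q, +oo[);
      rewrite setTI preimage_itvoy.
  move=> [A mA [N N0 ANE]].
  by exists (A, N).
pose A q := (projT1 (cid (split_q q))).1.
pose N q := (projT1 (cid (split_q q))).2.
have AN q : [/\ measurable (A q), mu.-negligible (N q) &
    A q `|` N q = [set t | ratr q < k t]].
  by rewrite /A /N; case: cid.
have [M [mM M0 NM]] :
    mu.-negligible (\bigcup_n (if unpickle n is Some q then N q else set0)).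
  apply: negligible_bigcup => n; case: unpickle => [q|].
    by have [] := AN q.
  exact: negligible_set0.
have NqM q : N q `<=` M.
  by move=> x Nx; apply: NM; exists (pickle q); [exact: I|rewrite pickleK].
exists (fun t => if t \in M then 0 else k t); last first.
  exists M; split => // t /=; case: ifPn; first by rewrite inE.
  by rewrite eqxx.
move=> _; apply: (measurability _ (RGenOInfty.measurableE R)) => //.
move=> _ [_ [r ->] <-]; rewrite setTI preimage_itvoy.
(* The new function is 0 on [M], so [M] lies in the superlevel set exactly when r < 0, that is, when
   some rational q satisfies r < q < 0. *)
rewrite [X in measurable X](_ : _ = \bigcup_(q in [set q : rat | r < ratr q])
    ((A q `&` ~` M) `|` (if ratr q < 0 :> R then M else set0))).
  rewrite bigcup_mkcond; apply: bigcupT_measurable_rat => q.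
  case: ifP => // _; apply: measurableU.
    by apply: measurableI; [have [] := AN q|exact: measurableC].
  by case: ifP.
apply/seteqP; split => [x /= rk|x [q /= rq]].
  have /rat_in_itvoo[q] := rk; rewrite inE/= => /itvP qE.
  exists q => /=; first by rewrite qE.
  move: rk qE; case: ifPn => [/set_mem Mx|/negP nMx] rk qE.
    by right; rewrite ifT// qE.
  have : (A q `|` N q) x by have [_ _ ->] := AN q; rewrite /= qE.
  by case=> [Aqx|/NqM Mx]; [left; split => // Mx|]; exfalso; apply: nMx;
    rewrite inE.
case=> [[Aqx nMx]|].
  rewrite memNset//; apply: lt_trans rq _.
  suff : (A q `|` N q) x by have [_ _ ->] := AN q.
  by left.
by case: ifP => // q0 Mx; rewrite mem_set//; exact: lt_trans q0.
Qed.

(** The identity map pushes the completed measure forward to the Borel one, so change of variables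
    transfers integrals of Borel functions. *)
Lemma integrable_completed D g : measurable D -> measurable_fun setT g ->
  leb.-integrable D (EFin \o g) ->
  mu.-integrable D (EFin \o g) /\
  \int[leb]_(t in D) g t = \int[mu]_(t in D) g t.
Proof.
move=> mD mg ig.
have mid : measurable_fun (setT : set cR) (idfun : cR -> measurableTypeR R).
  by move=> _ Y mY; rewrite setTI; exact: measurable_completed.
have meg : measurable_fun setT (EFin \o g) by exact/measurable_EFinP.
have eqmu h : (\int[pushforward (@completed_lebesgue_measure R)
    (idfun : cR -> measurableTypeR R)]_(t in D) h t = \int[mu]_(t in D) h t)%E.
  exact: eq_measure_integral.
have igp := integrable_pushforward mid meg ig mD.
split; last first.
  by rewrite /Rintegral -eqmu (integral_pushforward mid meg ig mD).
move/integrableP : igp => [_ ilt]; apply/integrableP; split.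
  exact: measurable_funTS.
by rewrite -eqmu.
Qed.

End completed_measure.

Lemma ae_eq_integrable d (T : measurableType d) (R : realType)
    (mu : {measure set T -> \bar R}) (D : set T) (f g : T -> \bar R) :
  measurable D -> measurable_fun D g -> ae_eq mu D f g ->
  mu.-integrable D f -> mu.-integrable D g.
Proof.
move=> mD mg fg /integrableP[mf flt]; apply/integrableP; split => //.
rewrite -(ae_eq_integral (abse \o g) (abse \o f)) //.
- exact: measurableT_comp.
- exact: measurableT_comp.
- exact: ae_eq_abse.
Qed.

(** * Integrating bounds on right increments *)

Section growth.
Context (R : realType).
Local Notation mu := (@lebesgue_measure R).
Local Notation cR := (caratheodory_type ((wlength (@idfun R))^*)%mu).

Lemma derivable_right_increment (H : normedModType R) (u : R -> H) (t e : R) :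
  derivable u t 1 -> 0 < e ->
  exists2 rho, 0 < rho & forall h, 0 < h -> h < rho ->
    `|u (t + h) - u t - h *: 'D_1 u t| <= e * h.
Proof.
move=> du e0; have /cvgrPdist_le/(_ _ e0) := du.
move=> /nbhs_ballP[rho /= rho0 hrho]; exists rho => // h h0 hr.
have := hrho h; rewrite /ball/= sub0r normrN gtr0_norm// => /(_ hr).
rewrite (gt_eqF h0) => /(_ isT); rewrite -(ler_pM2l h0) (mulrC h e).
apply: le_trans; rewrite -{3}(gtr0_norm h0) -normrZ scalerBr scalerA.
rewrite divff ?gt_eqF//.
by rewrite scale1r distrC [h%:A]mulr1 (addrC h).
Qed.

(** The integral of |g| over a set of small measure is small; apply this to the union of the
    intervals. *)
Lemma indefinite_integral_ac (g : R -> R) (a b : R) :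
  mu.-integrable setT (EFin \o g) ->
  absolutely_continuous_on a b (fun x => \int[mu]_(t in `]-oo, x]) g t).
Proof.
move=> ig e e0; have [d [d0 hd]] := integral_normr_continuous ig e0.
exists d => // n l r hlr tI hs.
have lr i : l i <= r i by have [_ []] := hlr i.
have igS D : measurable D -> mu.-integrable D (EFin \o g).
  by move=> mD; exact: integrableS ig.
pose E i : set R := `]l i, r i[%classic.
have mE i : measurable (E i) by exact: measurable_itv.
have incr i : `|\int[mu]_(t in `]-oo, r i]) g t -
    \int[mu]_(t in `]-oo, l i]) g t| <= \int[mu]_(t in E i) `|g t|.
  rewrite (Rintegral_itvB (igS _ (measurable_itv _))) ?bnd_simp//.
  rewrite -(Rintegral_itv_bndo_bndc (igS _ (measurable_itv _))).
  by apply: le_normr_Rintegral => //; exact: igS.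
apply: le_lt_trans (ler_sum _ (fun i _ => incr i)) _.
have -> : \sum_i \int[mu]_(t in E i) `|g t| =
    \int[mu]_(t in \big[setU/set0]_i E i) `|g t|.
  rewrite [RHS]/Rintegral ge0_integral_bigsetU//=.
  - rewrite -sum_fine//= => i _.
    have inormE := integrable_norm (igS _ (mE i)).
    by apply: (integrable_fin_num _ inormE); exact: mE.
  - exact: (index_enum_uniq 'I_n).
  - by move=> i j _ _; apply: (tI i j).
  - apply/measurable_EFinP/measurable_funTS; apply: measurableT_comp => //.
    by have /integrableP[/measurable_EFinP] := ig.
apply: hd; first by apply: bigsetU_measurable => i _; exact: mE.
by move: hs; rewrite -lte_fin -(measure_disjoint_itvoo lr tI).
Qed.

(** Let [F] be the indefinite integral of a Borel version of [k], extended by 0 outside [a, b]. By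
    Lebesgue differentiation [F] has derivative [k] almost everywhere on [a, b], so the right
    increments of [psi - F] are at most e h there and [ac_nonincreasing] applies. *)
Lemma ac_le_integral (a b : R) (psi k : R -> R) : a <= b ->
  absolutely_continuous_on a b psi -> leb.-integrable `[a, b] (EFin \o k) ->
  {ae leb, forall t, a <= t -> t < b -> forall e, 0 < e ->
    exists2 rho, 0 < rho & forall h, 0 < h -> h < rho ->
      psi (t + h) - psi t <= (k t + e) * h} ->
  psi b - psi a <= \int[leb]_(t in `[a, b]) k t.
Proof.
move=> ab ac ik dpsi.
have mab : measurable (`[a, b] : set R) by exact: measurable_itv.
have mabc : measurable (`[a, b]%classic : set cR).
  exact: measurable_completed.
pose k' := k \_ `[a, b].
have ik' : leb.-integrable (setT : set cR) (EFin \o k').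
  by have := (integrable_mkcond _ mabc).1 ik; rewrite restrict_EFin.
have mk' : measurable_fun (setT : set cR) k'.
  by have /integrableP[/measurable_EFinP] := ik'.
have [g mg gk'] := borel_version mk'.
have mgc : measurable_fun (setT : set cR) g.
  exact: (measurable_fun_completed measurableT mg).
have aegk' : ae_eq leb (setT : set cR) (EFin \o k') (EFin \o g).
  move/negligible_completed : gk'; apply: negligibleS => t /=.
  by move=> /not_implyP[_ ne]; apply/eqP => gk; apply: ne; rewrite /= gk.
have igc : leb.-integrable (setT : set cR) (EFin \o g).
  refine (ae_eq_integrable _ _ aegk' ik').
  exact: measurableT.
  apply/measurable_EFinP.
  exact: mgc.
have [ig _] := integrable_completed measurableT mg igc.
have igabc : leb.-integrable `[a, b] (EFin \o g).
  exact: integrableS igc.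
have [igab intab] := integrable_completed mab mg igabc.
pose F x := \int[mu]_(t in `]-oo, x]) g t.
have igS D : measurable D -> mu.-integrable D (EFin \o g).
  by move=> mD; exact: integrableS ig.
have -> : \int[leb]_(t in `[a, b]) k t = F b - F a.
  rewrite /F (Rintegral_itvB (igS _ (measurable_itv _))) ?bnd_simp//.
  rewrite (Rintegral_itv_obnd_cbnd (igS _ (measurable_itv _))).
  rewrite -intab /Rintegral; congr fine; apply: ae_eq_integral.
  - exact: mabc.
  - by have /integrableP[] := ik.
  - by have /integrableP[] := igabc.
  - apply: filterS aegk' => t /(_ I) /= <- abt.
    by rewrite /k' patchE mem_set.
pose N := [set t | g t != k' t] `|`
  ~` [set t | derivable F t 1 /\ F^`()%classic t = g t] `|`
  ~` [set t | a <= t -> t < b -> forall e, 0 < e ->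
    exists2 rho, 0 < rho & forall h, 0 < h -> h < rho ->
      psi (t + h) - psi t <= (k t + e) * h].
have N0 : mu.-negligible N.
  apply: negligibleU; last exact/negligible_completed.
  apply: negligibleU => //.
  apply: FTC1Ny; first by move=> y; exact: igS.
  by apply: open_integrable_locally => //; exact: openT.
suff : psi b - F b <= psi a - F a by lra.
apply: (@ac_nonincreasing _ a b (fun t => psi t - F t) N) => //.
  apply: absolutely_continuous_onD => //.
  apply: (absolutely_continuous_on_comp (K := 1)
    (indefinite_integral_ac a b ig)).
  by move=> s t _ _ _; rewrite mul1r -normrN opprB opprK addrC.
move=> t at_ tb nNt e e0.
have e2 : 0 < e / 2 by rewrite divr_gt0.
have [gk [[dF F'] dt]] : g t = k t /\
    (derivable F t 1 /\ F^`()%classic t = g t) /\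
    (forall e, 0 < e -> exists2 rho, 0 < rho & forall h, 0 < h -> h < rho ->
      psi (t + h) - psi t <= (k t + e) * h).
  split; [|split].
  - have -> : k t = k' t.
      by rewrite /k' patchE mem_set//= in_itv/= at_ ltW.
    by apply/eqP/negPn/negP => gk; apply: nNt; left; left.
  - by apply: contrapT => nd; apply: nNt; left; right.
  - by apply: contrapT => nd; apply: nNt; right => /= /(_ at_ tb).
have [rho1 rho10 h1] := dt _ e2.
have [rho2 rho20 h2] := derivable_right_increment dF e2.
exists (Num.min rho1 rho2); first by rewrite lt_min rho10.
move=> h h0; rewrite lt_min => /andP[hr1 hr2].
have := h2 _ h0 hr2; rewrite -derive1E F' gk ler_norml => /andP[lb _].
have := h1 _ h0 hr1; move: lb; rewrite -[h *: k t]/(h * k t).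
by move: (F (t + h)) (F t) (psi (t + h)) (psi t) => *; lra.
Qed.

End growth.

(** * Norms of strongly measurable functions *)

Section bochner.
Context (R : realType) (H : normedModType R).
Local Notation mu := (@lebesgue_measure R).
Local Notation cR := (caratheodory_type ((wlength (@idfun R))^*)%mu).

Lemma Lebesgue_simple_norm_measurable (s : R -> H) : Lebesgue_simple s ->
  measurable_fun (setT : set cR) (fun t => `|s t|).
Proof.
move=> [fs ms] _ Y mY; rewrite setTI.
have -> : (fun t => `|s t|) @^-1` Y =
    \bigcup_(y in range s `&` [set y | Y `|y|]) s @^-1` [set y].
  apply/seteqP; split => [t Yt|t [y [_ Yy] /= st]] /=; last by rewrite st.
  by exists (s t) => //; split => //; exists t.
by apply: fin_bigcup_measurable; [exact: finite_setIl|move=> y _; exact: ms].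
Qed.

(** Off a null set the norm is a pointwise limit of measurable functions; on the null set
    completeness of the measure makes every subset measurable. *)
Lemma strongly_measurable_norm (D : set R) (f : R -> H) : measurable D ->
  strongly_measurable D f -> measurable_fun (D : set cR) (fun t => `|f t|).
Proof.
move=> mD [s [ss [Z [mZ Z0 hZ]]]].
have mDc := measurable_completed mD.
have mDZ : measurable ((D `\` Z) : set cR) by exact: measurableD.
have mf : measurable_fun ((D `\` Z) : set cR) (fun t => `|f t|).
  apply: (@measurable_fun_cvg _ cR _ _ (fun n t => `|s n t|)).
    move=> n; apply: measurable_funTS.
    exact: Lebesgue_simple_norm_measurable.
  move=> t [Dt nZt]; apply: cvg_norm.
  by apply: contrapT => ns; apply: nZt; apply: hZ => /= /(_ Dt).
move=> _ Y mY.
have -> : D `&` (fun t => `|f t|) @^-1` Y =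
    ((D `\` Z) `&` (fun t => `|f t|) @^-1` Y) `|`
    ((D `&` Z) `&` (fun t => `|f t|) @^-1` Y).
  by rewrite -setIUl setUC setUIDK.
apply: measurableU; first exact: mf.
apply: completed_lebesgue_measure_is_complete; exists Z; split => //.
by move=> t [[]].
Qed.
End bochner.

(** * The perturbed gradient flow *)

Section half_line.
Context (R : realType).
Local Notation cR := (caratheodory_type ((wlength (@idfun R))^*)%mu).
Variables (t0 : R) (k : R -> R).
Hypothesis k_ge0 : forall t, t0 <= t -> 0 <= k t.
Hypothesis mk : measurable_fun (`[t0, +oo[%classic : set cR) (EFin \o k).

Lemma measurable_itv_completed (i : interval R) :
  measurable ([set` i] : set cR).
Proof. exact: (measurable_completed (measurable_itv i)). Qed.

Lemma half_line_bigcup :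
  \bigcup_n `[t0, (t0 + n%:R)[%classic = `[t0, +oo[%classic.
Proof.
apply/seteqP; split => [x [n _] /=|x /=]; rewrite !in_itv/= ?andbT.
  by case/andP.
move=> tx; exists (Num.truncn (x - t0)).+1 => //; rewrite /= in_itv/= tx/=.
by rewrite -ltrBlDl truncnS_gt.
Qed.

Lemma integral_half_line_le (K : \bar R) :
  (forall n, (\int[leb]_(t in `[t0, (t0 + n%:R)%R[) (k t)%:E <= K)%E) ->
  (\int[leb]_(t in `[t0, +oo[) (k t)%:E <= K)%E.
Proof.
move=> kK; pose F n : set cR := `[t0, (t0 + n%:R)[%classic.
have FE : \bigcup_n F n = `[t0, +oo[%classic := half_line_bigcup.
have FS n : F n `<=` `[t0, +oo[.
  by move=> x /=; rewrite !in_itv/= andbT => /andP[].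
have mF n : measurable (F n) by exact: measurable_itv_completed.
have cv : ((\int[leb]_(t in F n) (EFin \o k) t)%E @[n --> \oo] -->
    (\int[leb]_(t in \bigcup_n F n) (EFin \o k) t)%E).
  apply: ge0_nondecreasing_set_cvg_integral.
  - move=> n m nm; apply/subsetPset => x.
    rewrite /F/= !in_itv/= => /andP[-> /=].
    by move=> /lt_le_trans; apply; rewrite lerD2l ler_nat.
  - exact: mF.
  - move=> n; apply: measurable_funS mk; last exact: FS.
    exact: measurable_itv_completed.
  - by move=> n x /FS /=; rewrite in_itv/= andbT lee_fin => /k_ge0.
rewrite -FE -(cvg_lim _ cv)//; apply: lime_le.
  by apply/cvg_ex; eexists; exact: cv.
by apply: nearW => n; exact: kK.
Qed.

(** By monotone convergence some [t0, t0 + n[ carries more than the total minus e; intervals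
    disjoint from it share the rest. *)
Lemma integral_tail : (\int[leb]_(t in `[t0, +oo[) (k t)%:E < +oo)%E ->
  forall e, 0 < e -> exists2 s0, t0 <= s0 & forall s t, s0 <= s ->
    (\int[leb]_(r in `[s, t]) (k r)%:E <= e%:E)%E.
Proof.
set M := (\int[leb]_(t in `[t0, +oo[) (k t)%:E)%E => Moo e e0.
have M0 : (0 <= M)%E.
  by apply: integral_ge0 => t /=; rewrite in_itv/= andbT lee_fin => /k_ge0.
have Mfin : M \is a fin_num by rewrite ge0_fin_numE.
have [n hn] : exists n,
    (M - e%:E < \int[leb]_(t in `[t0, (t0 + n%:R)%R[) (k t)%:E)%E.
  apply: contrapT => nex.
  have : (M <= M - e%:E)%E.
    apply: integral_half_line_le => n; rewrite leNgt; apply/negP => hn.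
    by apply: nex; exists n.
  by rewrite leNgt lteBlDr// lteDl// lte_fin e0.
exists (t0 + n%:R); first by rewrite lerDl.
move=> s t ns.
have disj : [disjoint `[t0, (t0 + n%:R)[%classic & `[s, t]%classic].
  apply/disj_setPS => x [] /=; rewrite !in_itv/= => /andP[_ xn] /andP[sx _].
  by have := lt_le_trans xn (le_trans ns sx); rewrite ltxx.
have sub : `[t0, (t0 + n%:R)[%classic `|` `[s, t]%classic `<=` `[t0, +oo[.
  move=> x [] /=; rewrite !in_itv/= andbT => /andP[]// sx _.
  by apply: le_trans sx; apply: le_trans ns; rewrite lerDl.
have mU : measurable
    ((`[t0, (t0 + n%:R)[%classic `|` `[s, t]%classic) : set cR).
  by apply: measurableU; exact: measurable_itv_completed.
have : (\int[leb]_(r in `[t0, (t0 + n%:R)%R[%classic `|` `[s, t]%classic)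
    (k r)%:E <= M)%E.
  apply: (ge0_subset_integral _ _ _ mk _ sub).
  - exact: mU.
  - exact: measurable_itv_completed.
  - by move=> x /=; rewrite in_itv/= andbT lee_fin => /k_ge0.
have mkU := measurable_funS (measurable_itv_completed _) sub mk.
rewrite (ge0_integral_setU _ (measurable_itv_completed _)
  (measurable_itv_completed _) mkU _ disj).
  have ge0 (D : set cR) : D `<=` `[t0, +oo[ ->
      (0 <= \int[leb]_(r in D) (k r)%:E)%E.
    move=> DS; apply: integral_ge0 => r /DS /=.
    by rewrite in_itv/= andbT lee_fin => /k_ge0.
  move: (ge0 _ (subset_trans (@subsetUl _ _ _) sub)).
  move: (ge0 _ (subset_trans (@subsetUr _ _ _) sub)).
  clear Moo M0; clearbody M; move: hn Mfin; case: M => [m| |]//.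
  case: integral => [p| |]//; case: integral => [q| |]//.
  by rewrite -!EFinD lte_fin !lee_fin => *; lra.
by move=> x xU; have := sub x xU; rewrite /= in_itv/= andbT lee_fin => /k_ge0.
Qed.
End half_line.

(** * Gradient steps and growth estimates along the flow *)

Section cocoercive_flow.
Context (R : realType) (H : completeNormedModType R) (ip : {dot H for idfun}).
Hypothesis Hip : inner_product_of_norm ip.
Local Notation cR := (caratheodory_type ((wlength (@idfun R))^*)%mu).
Variables (S : H -> H) (c : R).
Hypothesis c_gt0 : 0 < c.
Hypothesis S_coco : forall x y,
  c * `|S x - S y| ^+ 2 <= ip (S x - S y) (x - y).

Lemma sqnorm_gradient_step x y (eta : R) :
  `|(x - eta *: S x) - (y - eta *: S y)| ^+ 2 =
  `|x - y| ^+ 2 - 2 * eta * ip (S x - S y) (x - y)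
  + eta ^+ 2 * `|S x - S y| ^+ 2.
Proof.
have -> : x - eta *: S x - (y - eta *: S y) = (x - y) - eta *: (S x - S y).
  by rewrite scalerBr !opprD !opprK addrACA.
move: (S x - S y) (x - y) => s d.
by rewrite -!Hip !ipE (ipC ip d s); ring.
Qed.

(** Let d be the increment of [S] along the step. Cocoercivity gives [c |d|^2 <= - eta <d, S y>], so
    2 <d, S y> compensates [|d|^2] as soon as [eta <= 2 c]. *)
Lemma norm_S_gradient_step (y : H) (eta : R) : 0 <= eta -> eta <= 2 * c ->
  `|S (y - eta *: S y)| <= `|S y|.
Proof.
move=> eta0 etac; have [->|eN0] := eqVneq eta 0.
  by rewrite scale0r subr0.
have eta1 : 0 < eta by rewrite lt_neqAle eq_sym eN0.
have := S_coco (y - eta *: S y) y.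
rewrite addrAC subrr sub0r; set z := S _; rewrite -(subrK (S y) z).
move: (z - S y) => d; rewrite addrK ipNr ipZr => h.
rewrite -(@ler_pXn2r _ 2) ?nnegrE// (normDsq Hip).
have d0 : 0 <= `|d| ^+ 2 by rewrite exprn_ge0.
by rewrite -(ler_pM2l eta1); nra.
Qed.

Lemma norm_dist_gradient_step (z y : H) (eta : R) : S z = 0 ->
  0 <= eta -> eta <= 2 * c -> `|y - eta *: S y - z| <= `|y - z|.
Proof.
move=> Sz eta0 etac; rewrite -(@ler_pXn2r _ 2) ?nnegrE//.
have := sqnorm_gradient_step y z eta; rewrite Sz scaler0 !subr0 => ->.
have := S_coco y z; rewrite Sz subr0 => h.
have s_le := ler_wpM2r (exprn_ge0 2 (normr_ge0 (S y))) etac.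
have : 0 <= eta * (2 * ip (S y) (y - z) - eta * `|S y| ^+ 2).
  by rewrite mulr_ge0//; lra.
by lra.
Qed.

Variables (t0 : R) (theta : R -> R) (f : R -> H) (u : R -> H).
Hypothesis theta_ge0 : forall t, t0 <= t -> 0 <= theta t.
Hypothesis theta_loc : locally_integrable_on `[t0, +oo[ theta.
Hypothesis f_int : Bochner_integrable `[t0, +oo[ f.
Hypothesis u_ac : forall b, t0 < b -> absolutely_continuous_on t0 b u.
Hypothesis u_ode : {ae leb, forall t, t0 <= t ->
  derivable u t 1 /\ 'D_1 u t + theta t *: S (u t) = f t}.

Lemma norm_f_measurable :
  measurable_fun (`[t0, +oo[%classic : set cR) (EFin \o (fun t => `|f t|)).
Proof.
apply/measurable_EFinP.
exact: (strongly_measurable_norm (measurable_itv _) f_int.1).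
Qed.

Lemma norm_f_integrable_half_line :
  leb.-integrable `[t0, +oo[ (EFin \o (fun t => `|f t|)).
Proof.
apply/integrableP; split; first exact: norm_f_measurable.
apply: le_lt_trans f_int.2; rewrite le_eqVlt; apply/orP; left; apply/eqP.
by apply: eq_integral => x _ /=; rewrite normr_id.
Qed.

Lemma subset_half_line (s t : R) : t0 <= s ->
  `[s, t]%classic `<=` `[t0, +oo[%classic.
Proof.
by move=> t0s x /=; rewrite !in_itv/= andbT => /andP[/(le_trans t0s)].
Qed.

Lemma norm_f_integrable (s t : R) : t0 <= s ->
  leb.-integrable `[s, t] (EFin \o (fun t => `|f t|)).
Proof.
move=> t0s; exact: (integrableS (measurable_itv_completed `[t0, +oo[)
  (measurable_itv_completed `[s, t]) (subset_half_line (t := t) t0s)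
  norm_f_integrable_half_line).
Qed.

Lemma u_ac_sub (s t : R) : t0 <= s -> absolutely_continuous_on s t u.
Proof.
move=> t0s.
have t0b : t0 < Num.max t0 t + 1 by rewrite ltr_pwDr// le_max lexx.
move=> e e0; have [d d0 hd] := u_ac t0b e0; exists d => // n l r hlr.
apply: hd => i; have [sl [lr rt]] := hlr i; split; first exact: le_trans sl.
by split => //; rewrite (le_trans rt)// ler_wpDr// le_max lexx orbT.
Qed.

(** By the equation, u (r + h) is the gradient step of size [h theta r] from [u r], plus h f r, up
    to o(h). The step does not increase [p], and the rest costs at most [L] times its norm. *)
Lemma flow_growth (p : H -> R) (L : R) (s t : R) : 0 <= L ->
  (forall x y, `|p x - p y| <= L * `|x - y|) ->
  (forall y (eta : R), 0 <= eta -> eta <= 2 * c -> p (y - eta *: S y) <= p y) ->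
  t0 <= s -> s <= t ->
  p (u t) - p (u s) <= L * \int[leb]_(r in `[s, t]) `|f r|.
Proof.
move=> L0 plip pstep t0s st.
have if_ := norm_f_integrable t t0s.
have mst := measurable_itv_completed `[s, t].
rewrite -(RintegralZl _ mst if_).
apply: (ac_le_integral (psi := p \o u)) => //.
- apply: (absolutely_continuous_on_comp (K := L) (@u_ac_sub s t t0s)).
  by move=> x y _ _ _; exact: plip.
- have := integrableZl mst L if_; apply: eq_integrable => //.
apply: (@filterS _ _ (ae_filter_ringOfSetsType leb) _ _ _ u_ode).
move=> r hr sr rt e e0.
have t0r : t0 <= r by exact: le_trans sr.
have [du ode] := hr t0r.
have L1 : 0 < L + 1 by rewrite ltr_wpDl.
have [rho rho0 hrho] := derivable_right_increment du (divr_gt0 e0 L1).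
have th1 : 0 < theta r + 1 by rewrite ltr_wpDl ?theta_ge0.
(* The second bound ensures [h theta r <= 2 c]; adding 1 keeps the quotient meaningful when
   [theta r] is 0. *)
exists (Num.min rho (2 * c / (theta r + 1))).
  by rewrite lt_min rho0 divr_gt0// mulr_gt0.
move=> h h0; rewrite lt_min => /andP[h_rho h_c].
have eta_c : h * theta r <= 2 * c.
  move: h_c; rewrite ltr_pdivlMr// => /ltW; apply: le_trans.
  by rewrite ler_pM2l// lerDl.
have := pstep (u r) (h * theta r) (mulr_ge0 (ltW h0) (theta_ge0 t0r)) eta_c.
set z := u r - _ => pz.
have := plip (u (r + h)) z => /(le_trans (ler_norm _)) pu.
have uz : `|u (r + h) - z| <= h * `|f r| + e / (L + 1) * h.
  have -> : u (r + h) - z = h *: f r + (u (r + h) - u r - h *: 'D_1 u r).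
    rewrite -ode scalerDr scalerA /z opprB.
    by rewrite [h *: _ + _]addrC addrACA subrr addr0 addrCA.
  rewrite (le_trans (ler_normD _ _))// normrZ gtr0_norm// lerD2l.
  exact: hrho.
have eL : L * (e / (L + 1)) <= e.
  by rewrite mulrCA ger_pMr// ler_pdivrMr// mul1r lerDl.
have := ler_wpM2l L0 uz; have := ler_wpM2r (ltW h0) eL => /=.
by move: (p (u (r + h))) (p (u r)) (p z) pz pu => *; lra.
Qed.

Lemma norm_f_integral_le (s t : R) : t0 <= s ->
  \int[leb]_(r in `[s, t]) `|f r| <= \int[leb]_(r in `[t0, +oo[) `|f r|.
Proof.
move=> t0s; apply: fine_le.
- exact: (integrable_fin_num (measurable_itv_completed _)
    (norm_f_integrable t t0s)).
- exact: (integrable_fin_num (measurable_itv_completed _)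
    norm_f_integrable_half_line).
apply: (ge0_subset_integral _ _ _ norm_f_measurable).
- exact: measurable_itv_completed.
- exact: measurable_itv_completed.
- by move=> x _; rewrite lee_fin.
- exact: subset_half_line.
Qed.

Lemma norm_S_flow_growth (s t : R) : t0 <= s -> s <= t ->
  `|S (u t)| - `|S (u s)| <= c^-1 * \int[leb]_(r in `[s, t]) `|f r|.
Proof.
apply: (flow_growth (p := fun x => `|S x|)).
- by rewrite invr_ge0 ltW.
- move=> x y; apply: le_trans (ler_dist_dist _ _) _.
  exact: (cocoercive_lipschitz Hip c_gt0 S_coco).
- exact: norm_S_gradient_step.
Qed.

Lemma dist_flow_growth (z : H) (s t : R) : S z = 0 -> t0 <= s -> s <= t ->
  `|u t - z| - `|u s - z| <= \int[leb]_(r in `[s, t]) `|f r|.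
Proof.
move=> Sz t0s st; rewrite -[leRHS]mul1r.
apply: (flow_growth (p := fun x => `|x - z|)) => //.
- move=> x y; rewrite mul1r; apply: le_trans (ler_dist_dist _ _) _.
  by rewrite opprB addrA subrK.
- by move=> y eta; exact: norm_dist_gradient_step.
Qed.

Definition flow_radius (z : H) : R :=
  `|u t0 - z| + \int[leb]_(r in `[t0, +oo[) `|f r|.

Lemma dist_flow_le (z : H) (t : R) : S z = 0 -> t0 <= t ->
  `|u t - z| <= flow_radius z.
Proof.
move=> Sz t0t; have := dist_flow_growth Sz (lexx t0) t0t.
by have := norm_f_integral_le t (lexx t0); rewrite /flow_radius; lra.
Qed.

Lemma norm_S_flow_le (z : H) (t : R) : S z = 0 -> t0 <= t ->
  `|S (u t)| <= c^-1 * flow_radius z.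
Proof.
move=> Sz t0t; have := cocoercive_lipschitz Hip c_gt0 S_coco (u t) z.
rewrite Sz subr0 => /le_trans; apply.
by rewrite ler_pM2l ?invr_gt0// dist_flow_le.
Qed.

Lemma norm_S_flow_measurable :
  measurable_fun (`[t0, +oo[%classic : set cR) (fun t => `|S (u t)|).
Proof.
(* Continuity of [u] is known only from t0 on; freezing time before t0 gives a function continuous
   on the whole line. *)
pose w t := `|S (u (Num.max t0 t))|.
have cw : continuous w.
  move=> x; apply/cvgrPdist_lt => e e0.
  have ce0 : 0 < c * e by rewrite mulr_gt0.
  have [d d0 hd] := absolutely_continuous_on_dist
    (u_ac_sub (Num.max t0 x + 1) (lexx t0)) ce0.
  have d10 : 0 < Num.min d 1 by rewrite lt_min d0 ltr01.
  near=> y.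
  have : `|x - y| < Num.min d 1.
    by near: y; apply: cvgr_dist_lt.
  rewrite lt_min => /andP[xyd xy1].
  have close s t : s <= t -> t - s < d -> t <= Num.max t0 x + 1 ->
      `|u (Num.max t0 t) - u (Num.max t0 s)| < c * e.
    move=> st std tb; apply: hd.
    - by rewrite le_max lexx.
    - by rewrite ge_max !le_max lexx/= st orbT.
    - by rewrite ge_max tb andbT ler_wpDr// le_max lexx.
    - apply: le_lt_trans std; have [t0t|tt0] := leP t0 t.
        by rewrite lerB// le_max lexx orbT.
      by rewrite (max_l (le_trans st (ltW tt0))) subrr subr_ge0.
  have lip v v' : `|u v - u v'| < c * e -> `| `|S (u v)| - `|S (u v')| | < e.
    move=> vv'; apply: le_lt_trans (ler_dist_dist _ _) _.
    apply: le_lt_trans (cocoercive_lipschitz Hip c_gt0 S_coco _ _) _.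
    by rewrite ltr_pdivrMl.
  have xb : x <= Num.max t0 x + 1 by rewrite ler_wpDr// le_max lexx orbT.
  move: xyd xy1; have [xy|yx] := leP x y => xyd xy1.
    rewrite distrC; apply: lip; apply: close => //.
      by move: xyd; rewrite ler0_norm ?subr_le0// opprB.
    move: xy1; rewrite ler0_norm ?subr_le0// opprB ltrBlDr addrC.
    move=> /ltW/le_trans; apply.
    by rewrite lerD2r le_max lexx orbT.
  apply: lip; apply: close => //; first exact: ltW.
  by move: xyd; rewrite gtr0_norm ?subr_gt0.
have mw : measurable_fun (`[t0, +oo[%classic : set cR) w.
  apply: (measurable_fun_completed (measurable_itv _)).
  exact: measurable_funTS (continuous_measurable_fun cw).
apply: (eq_measurable_fun _ _ mw) => x; rewrite inE/= in_itv/= andbT => tx.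
by rewrite /w max_r.
Unshelve. all: by end_near.
Qed.

Lemma theta_integrable (b : R) : leb.-integrable `[t0, b] (EFin \o theta).
Proof.
apply: theta_loc; first exact: segment_compact.
exact: subset_half_line.
Qed.

(** Up to the factor [c] and the contribution of [f], a lower bound for the decay rate of
    [|u - z|^2 / 2] at a zero z of [S]. *)
Definition dissipation (t : R) := theta t * `|S (u t)| ^+ 2.

Lemma dissipation_ge0 (t : R) : t0 <= t -> 0 <= dissipation t.
Proof. by move=> t0t; rewrite mulr_ge0 ?theta_ge0// exprn_ge0. Qed.

Lemma dissipation_integrable (z : H) (b : R) : S z = 0 ->
  leb.-integrable `[t0, b] (EFin \o dissipation).
Proof.
move=> Sz; have mb := measurable_itv_completed `[t0, b].
have mh : measurable_fun (`[t0, b]%classic : set cR) (fun t => `|S (u t)| ^+ 2).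
  apply: measurable_funX.
  apply: measurable_funS norm_S_flow_measurable.
    exact: measurable_itv_completed.
  exact: subset_half_line.
have bh : [bounded `|S (u x)| ^+ 2 : R | x in `[t0, b]%classic].
  exists ((c^-1 * flow_radius z) ^+ 2); split; first exact: num_real.
  move=> M /ltW hM x /=; rewrite in_itv/= => /andP[t0x _].
  rewrite ger0_norm ?exprn_ge0// (le_trans _ hM)// lerXn2r ?nnegrE//.
    by rewrite (le_trans _ (norm_S_flow_le Sz t0x)).
  exact: norm_S_flow_le.
have := integrableMl mb (theta_integrable b) mh bh.
by apply: (eq_integrable mb) => x _.
Qed.

Lemma dissipation_integral_le (z : H) (b : R) : S z = 0 -> t0 <= b ->
  \int[leb]_(t in `[t0, b]) dissipation t <=
  c^-1 * (2^-1 * `|u t0 - z| ^+ 2 +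
    flow_radius z * \int[leb]_(r in `[t0, +oo[) `|f r|).
Proof.
move=> Sz t0b; set B := flow_radius z.
have mb := measurable_itv_completed `[t0, b].
have if_ := norm_f_integrable b (lexx t0).
have id_ := dissipation_integrable b Sz.
have iB := integrableZl mb B if_.
have ic := integrableZl mb c id_.
have B0 : 0 <= B by rewrite (le_trans (normr_ge0 (u t0 - z)))// dist_flow_le.
pose k t := B * `|f t| - c * dissipation t.
have ik : leb.-integrable `[t0, b] (EFin \o k).
  have := integrableB mb iB ic.
  by apply: (eq_integrable mb) => x _.
have intk : \int[leb]_(t in `[t0, b]) k t =
    B * \int[leb]_(t in `[t0, b]) `|f t| -
    c * \int[leb]_(t in `[t0, b]) dissipation t.
  rewrite -(RintegralZl _ mb if_) -(RintegralZl _ mb id_) -RintegralB//.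
pose psi t := 2^-1 * `|u t - z| ^+ 2.
have growth : psi b - psi t0 <= \int[leb]_(t in `[t0, b]) k t.
  apply: ac_le_integral => //.
    apply: (absolutely_continuous_on_comp (K := B) (u_ac_sub b (lexx t0))).
    move=> s t t0s st tb.
    have hs := dist_flow_le Sz t0s.
    have ht := dist_flow_le Sz (le_trans t0s st).
    rewrite -/B in hs ht; rewrite /psi -mulrBr subr_sqr.
    rewrite normrM normrM (@ger0_norm _ 2^-1)//.
    rewrite (ger0_norm (addr_ge0 (normr_ge0 (u t - z)) (normr_ge0 (u s - z)))).
    have := ler_dist_dist (u t - z) (u s - z).
    rewrite opprB addrA subrK => hd.
    have := ler_pM (normr_ge0 _) (addr_ge0 (normr_ge0 _) (normr_ge0 _)) hd
      (lerD ht hs).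
    by lra.
  apply: (@filterS _ _ (ae_filter_ringOfSetsType leb) _ _ _ u_ode).
  move=> r hr t0r _ e e0; have [du ode] := hr t0r.
  set D := 'D_1 u r in ode.
  have B1 : 0 < 2 * (B + 1) by lra.
  (* The error e is split in halves: [B * e1 <= e / 2] for the term linear in the increment d, and
     [|d|^2 / 2 <= h e / 2] for the quadratic one. *)
  pose e1 := e / (2 * (B + 1)).
  have e10 : 0 < e1 by rewrite divr_gt0.
  have [rho rho0 hrho] := derivable_right_increment du e10.
  have q0 : 0 < (`|D| + e1) ^+ 2 + 1 by rewrite ltr_wpDl// sqr_ge0.
  exists (Num.min rho (e / ((`|D| + e1) ^+ 2 + 1))).
    by rewrite lt_min rho0 divr_gt0.
  move=> h h0; rewrite lt_min => /andP[h_rho h_e].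
  have := hrho _ h0 h_rho; rewrite -/D /psi /k /dissipation.
  have -> : u (r + h) - z = (u r - z) + (u (r + h) - u r).
    by rewrite [RHS]addrC addrA subrK.
  have wB := dist_flow_le Sz t0r; rewrite -/B in wB.
  have coco := S_coco (u r) z; rewrite Sz subr0 in coco.
  move: wB coco; set w := u r - z; set d := u (r + h) - u r => wB coco dD.
  rewrite (normDsq Hip).
  have d_le : `|d| <= h * (`|D| + e1).
    rewrite -(subrK (h *: D) d) (le_trans (ler_normD _ _))//.
    by rewrite normrZ gtr0_norm// mulrDr addrC lerD2l mulrC.
  have dd : `|d| ^+ 2 <= h * e.
    have : `|d| ^+ 2 <= (h * (`|D| + e1)) ^+ 2.
      by rewrite lerXn2r ?nnegrE// (le_trans _ d_le).
    move: h_e; rewrite ltr_pdivlMr// exprMn => he /le_trans; apply.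
    rewrite expr2 -mulrA ler_pM2l// (le_trans _ (ltW he))// ler_pM2l//.
    by rewrite lerDl.
  have wd : ip w d <= h * ip w D + B * (e1 * h).
    rewrite -{1}(subrK (h *: D) d) ipDr ipZr addrC lerD2l.
    rewrite (le_trans (ler_ip Hip _ _))//.
    rewrite (le_trans (ler_wpM2l (normr_ge0 _) dD))//.
    by rewrite ler_wpM2r// mulr_ge0 ?ltW.
  have Be1 : B * e1 <= e / 2.
    rewrite /e1 mulrA ler_pdivrMr// (mulrC B) -!mulrA ler_pM2l//.
    by lra.
  have wD : ip w D <= B * `|f r| - c * (theta r * `|S (u r)| ^+ 2).
    have -> : D = f r - theta r *: S (u r) by rewrite -ode addrK.
    rewrite ipDr ipNr ipZr lerD//.
      by rewrite (le_trans (ler_ip Hip _ _))// ler_wpM2r.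
    by rewrite lerN2 mulrCA (ipC ip w) ler_wpM2l ?theta_ge0.
  have := ler_wpM2l (ltW h0) wD; have := ler_wpM2l (ltW h0) Be1.
  by lra.
rewrite -ler_pdivrMl ?invr_gt0// invrK.
have If_le := ler_wpM2l B0 (norm_f_integral_le b (lexx t0)).
have psib : 0 <= psi b by rewrite mulr_ge0// exprn_ge0.
have psi0 : psi t0 = 2^-1 * `|u t0 - z| ^+ 2 by [].
rewrite -psi0; rewrite intk in growth.
move: psib growth If_le; clear.
move: (psi b) (psi t0) (\int[_]_(_ in _) dissipation _) (B * _) (B * _) => *.
lra.
Qed.

Lemma measurable_half_line (g : R -> R) :
  (forall b, leb.-integrable `[t0, b] (EFin \o g)) ->
  measurable_fun (`[t0, +oo[%classic : set cR) (EFin \o g).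
Proof.
move=> ig; rewrite -half_line_bigcup.
apply/measurable_fun_bigcup; first by move=> n; exact: measurable_itv_completed.
move=> n.
apply: (measurable_funS (measurable_itv_completed `[t0, t0 + n%:R])).
  by move=> x /=; rewrite !in_itv/= => /andP[-> /ltW].
by have /integrableP[] := ig (t0 + n%:R).
Qed.

Lemma dissipation_integral_lty (z : H) : S z = 0 ->
  (\int[leb]_(t in `[t0, +oo[) (dissipation t)%:E < +oo)%E.
Proof.
move=> Sz; set K := c^-1 * (2^-1 * `|u t0 - z| ^+ 2 +
    flow_radius z * \int[leb]_(r in `[t0, +oo[) `|f r|).
have md := measurable_half_line (fun b => dissipation_integrable b Sz).
apply: (@le_lt_trans _ _ K%:E); last exact: ltry.
apply: (integral_half_line_le dissipation_ge0 md) => n.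
have mb := measurable_itv_completed `[t0, t0 + n%:R].
have id_ := dissipation_integrable (t0 + n%:R) Sz.
apply: (@le_trans _ _
  (\int[leb]_(t in `[t0, (t0 + n%:R)%R]) (dissipation t)%:E)%E).
  apply: (ge0_subset_integral _ _ mb).
  - exact: measurable_itv_completed.
  - by have /integrableP[] := id_.
  - by move=> x /=; rewrite in_itv/= lee_fin => /andP[/dissipation_ge0].
  - by move=> x /=; rewrite !in_itv/= => /andP[-> /ltW].
rewrite -(fineK (integrable_fin_num mb id_)) lee_fin.
by apply: dissipation_integral_le => //; rewrite lerDl.
Qed.

(** Past a time where the tail of |f| is small, |S (u s)| must drop below e / 2 somewhere: otherwise
    [theta <= (e / 2)^-2 dissipation] would be integrable there. From that s on it can grow by at
    most e / 2. *)
Lemma norm_S_flow_cvg0 (z : H) : S z = 0 ->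
  (\int[leb]_(t in `[t0, +oo[) (theta t)%:E = +oo)%E ->
  `|S (u t)| @[t --> +oo] --> (0 : R).
Proof.
move=> Sz theta_oo; apply/cvgr0Pnorm_le => e e0.
(* The factor [c] cancels the Lipschitz constant of [S] in [norm_S_flow_growth]. *)
have ce0 : 0 < c * (e / 2) by rewrite mulr_gt0// divr_gt0.
have f_lty : (\int[leb]_(t in `[t0, +oo[) `|f t|%:E < +oo)%E by exact: f_int.2.
have [s0 t0s0 tail] := integral_tail (fun t _ => normr_ge0 (f t))
  norm_f_measurable f_lty ce0.
have [s s0s phis] : exists2 s, s0 <= s & `|S (u s)| < e / 2.
  apply: contrapT => nex.
  have phi_ge t : s0 <= t -> e / 2 <= `|S (u t)|.
    by move=> s0t; rewrite leNgt; apply/negP => ?; apply: nex; exists t.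
  have mth := measurable_half_line theta_integrable.
  have md := measurable_half_line (fun b => dissipation_integrable b Sz).
  have splitU : `[t0, +oo[%classic = `[t0, s0]%classic `|` `]s0, +oo[%classic.
    apply/seteqP; split=> x /=; rewrite !in_itv/= ?andbT.
      by move=> t0x; have [xs|] := leP x s0; [left; rewrite t0x|right].
    by case=> [/andP[]//|/ltW]; exact: le_trans.
  have disj : [disjoint `[t0, s0]%classic & `]s0, +oo[%classic].
    apply/disj_setPS => x [] /=; rewrite !in_itv/= andbT => /andP[_ xs].
    by move=> /(le_lt_trans xs); rewrite ltxx.
  have sub : `]s0, +oo[%classic `<=` `[t0, +oo[%classic.
    by rewrite splitU; exact: subsetUr.
  pose K := (e / 2) ^- 2.
  have e20 : 0 < e / 2 by rewrite divr_gt0.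
  have K0 : 0 <= K by rewrite invr_ge0 exprn_ge0// ltW.
  have mi := measurable_itv_completed `]s0, +oo[.
  have md' := measurable_funS (measurable_itv_completed _) sub md.
  have mth' := measurable_funS (measurable_itv_completed _) sub mth.
  have t0_lt x : s0 < x -> t0 <= x by move=> /ltW; exact: le_trans.
  have d0 x : `]s0, +oo[%classic x -> (0 <= (dissipation x)%:E)%E.
    by rewrite /= in_itv/= andbT lee_fin => /t0_lt/dissipation_ge0.
  have dis_lty : (\int[leb]_(t in `]s0, +oo[) (dissipation t)%:E < +oo)%E.
    apply: le_lt_trans (dissipation_integral_lty Sz).
    apply: (ge0_subset_integral _ mi _ md _ sub).
      exact: measurable_itv_completed.
    by move=> x /=; rewrite in_itv/= andbT lee_fin => /dissipation_ge0.
  have theta_lty : (\int[leb]_(t in `]s0, +oo[) (theta t)%:E < +oo)%E.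
    apply: (@le_lt_trans _ _
      (K%:E * \int[leb]_(t in `]s0, +oo[) (dissipation t)%:E)%E).
      rewrite -(ge0_integralZl_EFin _ mi d0 md' K0).
      apply: (ge0_le_integral _ mi).
      - by move=> x /=; rewrite in_itv/= andbT lee_fin => /t0_lt/theta_ge0.
      - exact: mth'.
      - exact: measurable_funeM.
      move=> x /=; rewrite in_itv/= andbT -EFinM lee_fin => s0x.
      rewrite /K /dissipation mulrCA ler_peMr ?theta_ge0 ?t0_lt//.
      rewrite mulrC ler_pdivlMr ?exprn_gt0// mul1r lerXn2r ?nnegrE ?(ltW e20)//.
      exact/phi_ge/ltW.
    by apply: lte_mul_pinfty; rewrite ?lee_fin.
  have : (\int[leb]_(t in `[t0, +oo[) (theta t)%:E < +oo)%E.
    rewrite splitU in mth *.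
    rewrite (ge0_integral_setU _ (measurable_itv_completed _) mi mth _ disj).
      apply: lte_add_pinfty => //.
      have mb := measurable_itv_completed `[t0, s0].
      by rewrite -(fineK (integrable_fin_num mb (theta_integrable s0))) ltry.
    by rewrite -splitU => x /=; rewrite in_itv/= andbT lee_fin => /theta_ge0.
  by rewrite theta_oo ltxx.
near=> t; rewrite normr_id.
have st : s <= t by near: t; exact: nbhs_pinfty_ge (num_real s).
have := norm_S_flow_growth (le_trans t0s0 s0s) st.
have := tail s t s0s.
have ifs := integrable_fin_num (measurable_itv_completed _)
  (norm_f_integrable t (le_trans t0s0 s0s)).
rewrite -(fineK ifs) lee_fin => h1 h2.
have : c^-1 * \int[leb]_(r in `[s, t]) `|f r| <= e / 2.
  by rewrite ler_pdivrMl.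
by lra.
Unshelve. all: by end_near.
Qed.

End cocoercive_flow.

(** * Opial's lemma *)

Section opial.
Context (R : realType) (H : completeNormedModType R) (ip : {dot H for idfun}).
Hypothesis Hip : inner_product_of_norm ip.

(** Take a limit l along an ultrafilter finer than +oo. For t large, pick s before and r after t
    with both values close to l: near monotonicity traps [q t] between them. *)
Lemma nearly_nonincreasing_cvg (q : R -> R) (t0 : R) :
  (forall t, t0 <= t -> 0 <= q t) ->
  (forall e, 0 < e -> exists2 s0, t0 <= s0 &
    forall s t, s0 <= s -> s <= t -> q t <= q s + e) ->
  cvg (q t @[t --> +oo]).
Proof.
move=> q0 qdec.
have [F [FU Foo]] := ultraFilterLemma (@proper_pinfty_nbhs R).
have FP : ProperFilter F by exact: ultra_proper.
have Fge s : F [set t | s <= t].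
  by apply: Foo; exact: nbhs_pinfty_ge (num_real s).
have /cvg_ex[l ql] : cvg (q @ F).
  have [s0 t0s0 hs0] := qdec 1 ltr01.
  apply: (@ultrafilter_bounded_cvg _ _ F q (q s0 + 1) FU).
  apply: filterS (Fge s0) => t /= s0t.
  by rewrite ger0_norm ?hs0// q0// (le_trans t0s0).
apply/cvg_ex; exists l; apply/cvgrPdist_le => e e0.
have e2 : 0 < e / 2 by rewrite divr_gt0.
have [s0 t0s0 hs0] := qdec _ e2.
have Fnear s : F [set t | s <= t /\ `|l - q t| <= e / 2].
  by apply: filterI; [exact: Fge|move/cvgrPdist_le : ql; exact].
have /filter_ex[s [s0s ls]] := Fnear s0.
near=> t.
have st : s <= t by near: t; exact: nbhs_pinfty_ge (num_real s).
have /filter_ex[r [tr lr]] := Fnear t.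
have := hs0 _ _ s0s st; have := hs0 _ _ (le_trans s0s st) tr.
move: ls lr; rewrite !ler_norml => /andP[? ?] /andP[? ?] ? ?.
by apply/andP; split; lra.
Unshelve. all: by end_near.
Qed.

(* Weak cluster points are encoded as weak limits along finer ultrafilters. *)
Lemma opial T (G : set_system T) (u : T -> H) (Z : set H) :
  ProperFilter G -> Z !=set0 ->
  (forall z, Z z -> cvg (`|u t - z| @[t --> G])) ->
  (forall F p, UltraFilter F -> G `<=` F -> weakly_cvg ip (u @ F) p -> Z p) ->
  exists2 p, Z p & weakly_cvg ip (u @ G) p.
Proof.
move=> GP [z0 Zz0] distcvg cluster_Z.
have [M GM] : exists M, G [set t | `|u t| <= M].
  have /cvg_ex[l hl] := distcvg _ Zz0.
  exists (l + 1 + `|z0|); have /cvgrPdist_le/(_ 1 ltr01) := hl.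
  apply: filterS => t /=; rewrite ler_norml => /andP[h _].
  have := ler_normD (u t - z0) z0; rewrite subrK.
  by move: h; lra.
have wcl F : UltraFilter F -> G `<=` F ->
    exists2 p, Z p & weakly_cvg ip (u @ F) p.
  move=> FU GF; have [p hp] := ultrafilter_weak_cvg Hip FU (GF _ GM).
  by exists p => //; exact: cluster_Z hp.
(* The product <u t, p - q> is a combination of the two squared distances, so it converges along all
   of [G]. Hence <p, p - q> and <q, p - q> agree and [|p - q|^2 = 0]. *)
have uniq F F' p q : UltraFilter F -> UltraFilter F' -> G `<=` F -> G `<=` F' ->
    Z p -> Z q -> weakly_cvg ip (u @ F) p -> weakly_cvg ip (u @ F') q -> p = q.
  move=> FU FU' GF GF' Zp Zq up uq.
  have /cvg_ex[a ha] := distcvg _ Zp; have /cvg_ex[b hb] := distcvg _ Zq.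
  have ipE t : ip (u t) (p - q) =
      2^-1 * (`|u t - q| ^+ 2 - `|u t - p| ^+ 2 + `|p| ^+ 2 - `|q| ^+ 2).
    by rewrite !(normBsq Hip) ipDr ipNr; field.
  pose m := 2^-1 * (b ^+ 2 - a ^+ 2 + `|p| ^+ 2 - `|q| ^+ 2).
  have sq (g : T -> R) (l : R) : g @ G --> l -> g t ^+ 2 @[t --> G] --> l ^+ 2.
    move=> gl; under eq_fun do rewrite expr2.
    by rewrite expr2; apply: cvgM.
  have ipm : ip (u t) (p - q) @[t --> G] --> m.
    under eq_fun do rewrite ipE.
    apply: cvgMr; apply: cvgB; last exact: cvg_cst.
    apply: cvgD; last exact: cvg_cst.
    by apply: cvgB; exact: sq.
  have lim_m (F0 : set_system T) (r : H) : UltraFilter F0 -> G `<=` F0 ->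
      weakly_cvg ip (u @ F0) r -> ip r (p - q) = m.
    move=> FU0 GF0 ur; have FP : ProperFilter F0 by exact: ultra_proper.
    have ur' : ip (u t) (p - q) @[t --> F0] --> ip r (p - q) := ur (p - q).
    have um' : ip (u t) (p - q) @[t --> F0] --> m.
      by apply: cvg_trans ipm => A /=; exact: GF0.
    exact: cvg_unique ur' um'.
  apply/eqP; rewrite -subr_eq0 -normr_eq0 -sqrf_eq0 -Hip ipDl ipNl.
  by rewrite (lim_m F p)// (lim_m F' q)// subrr.
have [F [FU GF]] := ultraFilterLemma GP.
have [p Zp up] := wcl F FU GF.
exists p => // y V yV; apply: contrapT => nGV.
(* If convergence fails, [E] meets every set of [G]; an ultrafilter refining both must again have
   weak limit p, which contradicts [E]. *)
pose E := ~` [set t | V (ip (u t) y)].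
have EP : ProperFilter (within E G).
  split; last exact: within_filter.
  rewrite /within/= => h; apply: nGV; apply: filterS h => t /= h.
  exact: contrapT.
have [F' [FU' EF']] := ultraFilterLemma EP.
have GF' : G `<=` F'.
  by move=> A GA; apply: EF'; rewrite /within/=; apply: filterS GA.
have [q Zq uq] := wcl F' FU' GF'.
have FP' : ProperFilter F' by exact: ultra_proper.
have qp := uniq _ _ _ _ FU FU' GF GF' Zp Zq up uq.
have FV : F' [set t | V (ip (u t) y)] by apply: (uq y); rewrite -qp.
have FE : F' E by apply: EF'; rewrite /within/=; apply: filterE.
by have [t [Vt nVt]] := filter_ex (filterI FV FE).
Qed.

End opial.

Theorem theorem4p4 (R : realType) (H : completeNormedModType R)
  (ip : {dot H for idfun}) (Hip : inner_product_of_norm ip)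
  (A B : H -> set H) (alpha beta lambda mu gamma delta : R)
  (t0 : R) (theta : R -> R) (f : R -> H) (u0 : H) (u : R -> H)
  (T := relaxed_resolvent delta mu B \o relaxed_resolvent gamma lambda A)
  (hA : max_monotone_op ip alpha A) (hB : max_monotone_op ip beta B)
  (hmu : mu = 2) (hlambda : lambda = 2)
  (hgd : gamma = delta) (hgamma : 0 < gamma)
  (hab : 0 < alpha + beta)
  (hgab : -1 < gamma * alpha * beta / (alpha + beta))
  (ht0 : 0 < t0)
  (htheta_ge0 : forall t, t0 <= t -> 0 <= theta t)
  (htheta_loc : locally_integrable_on `[t0, +oo[ theta)
  (htheta_oo : (\int[leb]_(s in `[t0, +oo[) (theta s)%:E = +oo)%E)
  (hf : Bochner_integrable `[t0, +oo[ f)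
  (* without a fixed point every claim may fail: for H = R, A and B the normal
     cones of {0} and {1}, alpha = beta = gamma = 1, one gets T x = x + 2 *)
  (hFix : Fix T !=set0)
  (hu : strong_global_solution t0 theta f T u0 u) :
  [/\ (\int[leb]_(s in `[t0, +oo[)
         (theta s * `|T (u s) - u s| ^+ 2)%:E < +oo)%E,
      `|T (u t) - u t| @[t --> +oo] --> (0 : R)
    & demiclosedness_principle ip T ->
      exists2 uhat : H, Fix T uhat & weakly_cvg ip (u @ +oo) uhat].
Proof.
have TE : T = relaxed_resolvent gamma 2 B \o relaxed_resolvent gamma 2 A.
  by rewrite /T hmu hlambda hgd.
clearbody T.
pose c := (1 + gamma * alpha * beta / (alpha + beta)) / 2.
have c_gt0 : 0 < c by rewrite /c; lra.
pose S x := x - T x.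
have S_coco x y : c * `|S x - S y| ^+ 2 <= ip (S x - S y) (x - y).
  exact: (reflected_composition_cocoercive Hip x y hA hB).
have Fix_S z : Fix T z <-> S z = 0.
  split=> [Tz|/eqP]; first by rewrite /S Tz subrr.
  by rewrite subr_eq0 => /eqP/esym.
have normS x : `|T x - x| = `|S x| by rewrite distrC.
have [z /Fix_S Sz] := hFix.
have [u_ac u_ode _] := hu.
have S_cvg0 : `|S (u t)| @[t --> +oo] --> (0 : R).
  exact: (norm_S_flow_cvg0 Hip c_gt0 S_coco htheta_ge0 htheta_loc hf
    u_ac u_ode Sz).
split.
- have := dissipation_integral_lty Hip c_gt0 S_coco htheta_ge0 htheta_loc hf
    u_ac u_ode Sz.
  by under eq_integral do rewrite /dissipation -normS.
- by under eq_fun do rewrite normS.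
move=> _; apply: (opial Hip _ hFix).
- move=> w /Fix_S Sw.
  apply: (nearly_nonincreasing_cvg (t0 := t0)) => // e e0.
  have f_lty : (\int[leb]_(t in `[t0, +oo[) `|f t|%:E < +oo)%E by exact: hf.2.
  have [s0 t0s0 tail] := integral_tail (fun t _ => normr_ge0 (f t))
    (norm_f_measurable hf) f_lty e0.
  exists s0 => // s t s0s st.
  have t0s := le_trans t0s0 s0s.
  have := dist_flow_growth Hip c_gt0 S_coco htheta_ge0 hf u_ac u_ode Sw t0s st.
  have := tail s t s0s.
  rewrite -(fineK (integrable_fin_num (measurable_itv_completed _)
    (norm_f_integrable hf t t0s))) lee_fin => h1 h2.
  by rewrite -lerBlDl (le_trans h2).
- move=> F p FU Foo up; apply/Fix_S.
  have FP : ProperFilter F by exact: ultra_proper.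
  apply: (cocoercive_weak_zero Hip FP c_gt0 S_coco _ up); last first.
    by apply: cvg_trans S_cvg0 => V /=; exact: Foo.
  exists (flow_radius t0 f u z + `|z|).
  apply: Foo; near=> t.
  have t0t : t0 <= t by near: t; exact: nbhs_pinfty_ge (num_real t0).
  rewrite /= -(subrK z (u t)) (le_trans (ler_normD _ _))// lerD2r.
  exact: (dist_flow_le Hip c_gt0 S_coco htheta_ge0 hf u_ac u_ode Sz).
Unshelve. all: by end_near.
Qed.
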